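(* Let $1<p<\infty$, let $q$ satisfy $pq=p+q$, and let $\Omega=\{(u,v)\in\mathbb{R}^2:|u|^p+|v|^p\le1\}$. Then $\cos_\Omega\theta=\cos_p\theta$ and $\sin_\Omega\theta=\sin_p\theta$ for all $\theta\in\mathbb{R}$. The polar set $\Omega^\circ$ is $\{(u,v):|u|^q+|v|^q\le1\}$; for each $\theta$ the angle $\theta^\circ$ with $\theta\xleftrightarrow{\Omega}\theta^\circ$ is unique modulo $2\mathbb{S}_q$ and is given by the unique solution of $\varphi_q(\theta^\circ)=\varphi_p(\theta)$; and $\cos_{\Omega^\circ}\theta^\circ=\cos_q\theta^\circ$, $\sin_{\Omega^\circ}\theta^\circ=\sin_q\theta^\circ$. In particular the area of $\Omega$ equals $\mathbb{S}_p=\dfrac{4\Gamma^2(1+\frac1p)}{\Gamma(1+\frac2p)}$.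
   Context: Convex trigonometry: for compact convex $\Omega\subset\mathbb{R}^2$ with $0\in\operatorname{int}\Omega$ and area $\mathbb{S}$, and $\theta\in[0,2\mathbb{S})$, let $P_\theta\in\partial\Omega$ be the point such that the area of the sector of $\Omega$ swept counterclockwise from the positive $x$-axis to the ray $OP_\theta$ equals $\theta/2$; $(\cos_\Omega\theta,\sin_\Omega\theta)$ are the coordinates of $P_\theta$, extended $2\mathbb{S}$-periodically. $\Omega^\circ=\{(p,q):pu+qv\le1\ \forall(u,v)\in\Omega\}$ is the polar set, with $\cos_{\Omega^\circ},\sin_{\Omega^\circ}$ defined likewise; $\theta\xleftrightarrow{\Omega}\theta^\circ$ means $\cos_\Omega\theta\cos_{\Omega^\circ}\theta^\circ+\sin_\Omega\theta\sin_{\Omega^\circ}\theta^\circ=1$. Generalized $L_p$ trigonometric functions: let $B(x;a,b)=\int_0^xt^{a-1}(1-t)^{b-1}dt$ be the incomplete Euler beta integral, $\mathbb{S}_p=4\Gamma^2(1+\frac1p)/\Gamma(1+\frac2p)$, and for $\varphi\in\mathbb{R}$ with $k=\lfloor4\varphi/\pi\rfloor$ put \[ \Theta_p(\varphi)=\frac{k-\lfloor k/2\rfloor}{2}\,\mathbb{S}_p+(-1)^k\,\tfrac1p4^{-1/p}\,B\big(\sin^22\varphi;\tfrac1p,\tfrac12\big). \] $\Theta_p$ is a strictly increasing bijection $\mathbb{R}\to\mathbb{R}$; let $\varphi_p=\Theta_p^{-1}$ and define $\cos_p\theta=|\cos\varphi_p(\theta)|^{2/p}\operatorname{sgn}\cos\varphi_p(\theta)$,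 $\sin_p\theta=|\sin\varphi_p(\theta)|^{2/p}\operatorname{sgn}\sin\varphi_p(\theta)$. The objects $\mathbb{S}_q,\varphi_q,\cos_q,\sin_q$ are defined by the same formulas with $p$ replaced by $q$. *)

(* Defs.v *)
From HB Require Import structures.
From mathcomp Require Import all_boot all_order all_algebra.
From mathcomp Require Import all_classical all_reals all_analysis.
Set Implicit Arguments. Unset Strict Implicit. Unset Printing Implicit Defensive.
Import Order.TTheory GRing.Theory Num.Theory.
Import numFieldNormedType.Exports.
Local Open Scope classical_set_scope.
Local Open Scope ring_scope.

Section Defs.
Variable R : realType.

Definition area (A : set (R * R)) : \bar R :=
  ((@lebesgue_measure R) \x (@lebesgue_measure R))%E A.

Definition bdry (A : set (R * R)) : set (R * R) := closure A `\` interior A.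

Definition sector (A : set (R * R)) (alpha : R) : set (R * R) :=
  [set x | A x /\ exists r t, 0 <= r /\ 0 <= t <= alpha /\ x = (r * cos t, r * sin t)].

Definition reduce (S theta : R) : R :=
  theta - 2 * S * (Num.floor (theta / (2 * S)))%:~R.

Definition is_Ptheta (A : set (R * R)) (theta : R) (P : R * R) : Prop :=
  bdry A P /\
  exists alpha rho, 0 <= alpha < 2 * pi /\ 0 < rho /\
    P = (rho * cos alpha, rho * sin alpha) /\
    area (sector A alpha) = (reduce (fine (area A)) theta / 2)%:E.

Definition Ptheta (A : set (R * R)) (theta : R) : R * R :=
  xget (0, 0) (is_Ptheta A theta).

Definition cosO (A : set (R * R)) (theta : R) : R := (Ptheta A theta).1.
Definition sinO (A : set (R * R)) (theta : R) : R := (Ptheta A theta).2.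

Definition polar (A : set (R * R)) : set (R * R) :=
  [set z | forall w, A w -> z.1 * w.1 + z.2 * w.2 <= 1].

Definition dual_angle (A : set (R * R)) (theta thetao : R) : Prop :=
  cosO A theta * cosO (polar A) thetao + sinO A theta * sinO (polar A) thetao = 1.

Definition pball (p : R) : set (R * R) :=
  [set w | `|w.1| `^ p + `|w.2| `^ p <= 1].

Definition Gamma (x : R) : R :=
  fine (\int[@lebesgue_measure R]_(t in `[(0%R : R), +oo[%classic)
          (t `^ (x - 1) * expR (- t))%:E)%E.

Definition incB (x a b : R) : R :=
  fine (\int[@lebesgue_measure R]_(t in `[(0%R : R), x]%classic)
          (t `^ (a - 1) * (1 - t) `^ (b - 1))%:E)%E.

Definition Sp (p : R) : R := 4 * Gamma (1 + p^-1) ^+ 2 / Gamma (1 + 2 / p).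

Definition Theta (p phi : R) : R :=
  let k : int := Num.floor (4 * phi / pi) in
  ((k%:~R - (Num.floor (k%:~R / 2 : R))%:~R) / 2) * Sp p
  + (-1) ^ k * (p^-1 * 4 `^ (- p^-1) * incB (sin (2 * phi) ^+ 2) p^-1 2^-1).

Definition varphi (p theta : R) : R := xget 0 [set phi | Theta p phi = theta].

Definition cosp (p theta : R) : R :=
  `|cos (varphi p theta)| `^ (2 / p) * Num.sg (cos (varphi p theta)).
Definition sinp (p theta : R) : R :=
  `|sin (varphi p theta)| `^ (2 / p) * Num.sg (sin (varphi p theta)).

End Defs.

(* Main.v *)
Require Import Defs.
From HB Require Import structures.
From mathcomp Require Import all_boot all_order all_algebra.
From mathcomp Require Import all_classical all_reals all_analysis.
From mathcomp Require Import measurable_realfun zify ring lra.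
Set Implicit Arguments. Unset Strict Implicit. Unset Printing Implicit Defensive.
Import Order.TTheory GRing.Theory Num.Theory.
Import numFieldNormedType.Exports.
Local Open Scope classical_set_scope.
Local Open Scope ring_scope.

(** In the first quadrant write the boundary point as ((1-w)^(1/p), w^(1/p))
with w = sin^2 phi.  The area swept up to it is
F(w) = int_0^(w^(1/p)) (1-y^p)^(1/p) dy - (w(1-w))^(1/p)/2, and
F'(w) = (w(1-w))^(1/p-1)/(2p), so that F(w) + F(1-w) = F(1) and the substitution
t = 4w(1-w) turns F into an incomplete beta integral; hence
Theta_p(n pi/2 + psi) = 2(n F(1) + F(sin^2 psi)) is twice the swept area.
The constant F(1) is computed by integrating exp(-x^p-y^p) over the quadrant and
slicing exp(-u) into the integral of exp(-t) over t >= u, which gives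
Gamma(1+1/p)^2 = F(1) Gamma(1+2/p).  The polarity statements are the equality
case of Young's inequality applied to the pairs (cos^2, sin^2) of the two angles. *)

(** * Continuity of powers, and integrals with endpoint singularities *)

Section Calculus.
Variable R : realType.
Notation mu := (@lebesgue_measure R).

(** Two angles must be kept apart. Sectors are cut by the polar angle [alpha] of a ray, whereas
    [Theta] and [varphi] use a parameter [phi] whose boundary point has the signed powers of cos phi
    and sin phi with exponent 2/p as coordinates. Inside a quadrant the two generally differ, but
    they advance together by quarter turns; since the ball is invariant under a quarter turn, all
    analysis takes place in one quadrant, and the other quadrants only contribute multiples of F(1).
    A boundary point is specified by the existence of some polar angle with the right area, so the
    translation is needed both ways: from [phi] to a ray to exhibit the point, and from a ray back
    to [phi] to show that there is no other one. The analytic obstacle is that for p > 1 the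
    integrands blow up at endpoints, while [incB] and [Gamma] are [fine] parts of extended
    integrals, which silently become 0 on divergence. The beta integrals are therefore evaluated
    exactly, through an antiderivative that is only assumed continuous at the endpoints, and the
    Gamma integrals are shown to be finite. *)

Lemma continuous_powR_gt0 (a x : R) : 0 < x ->
  (fun t : R => t `^ a) t @[t --> x] --> x `^ a.
Proof.
move=> x0; have : derivable (fun t : R => t `^ a) x 1.
  by apply: derivable_powR; rewrite in_itv/= andbT.
by move=> /derivable1_diffP/differentiable_continuous.
Qed.

(** A power with negative base is 1 by convention, so only the absolute value makes the power
    continuous across 0. *)
Lemma continuous_normr_powR (a : R) : 0 < a -> continuous (fun x : R => `|x| `^ a).
Proof.
move=> a0 x; have [->|x0] := eqVneq x 0.
  rewrite /continuous_at normr0 powR0 ?gt_eqF//.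
  apply/cvgrPdist_lt => e e0; near=> t.
  rewrite sub0r normrN ger0_norm ?powR_ge0//.
  have -> : e = (e `^ a^-1) `^ a by rewrite -powRrM mulVf ?gt_eqF// powRr1 ?ltW.
  apply: gt0_ltr_powR => //; rewrite ?nnegrE ?powR_ge0//.
  near: t; exists (e `^ a^-1) => /=; last by move=> y /=; rewrite sub0r normrN.
  by rewrite powR_gt0.
have cn : (fun t : R => `|t|) t @[t --> (x : R)] --> `|x : R|.
  exact: norm_continuous.
have x0' : 0 < `|x : R| by rewrite normr_gt0.
exact: (cvg_comp _ _ cn (@continuous_powR_gt0 a _ x0')).
Unshelve. all: by end_near. Qed.

(** [f] may be unbounded at both endpoints: the fundamental theorem is applied on closed intervals
    exhausting the open one, with monotone convergence on the side of [f] and continuity on the side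
    of [F]. *)
Lemma ge0_FTC2 (f F : R -> R) (a b : R) : a < b ->
  {in `]a, b[, forall x, 0 <= f x} ->
  {in `]a, b[, continuous f} ->
  {in `]a, b[, forall x : R, is_derive x (1 : R) F (f x)} ->
  continuous F ->
  (\int[mu]_(x in `[a, b]) (f x)%:E = (F b - F a)%:E)%E.
Proof.
move=> ab f0 cf dF cF.
(* Denominators starting at 3 keep [a + d n] below [b - d n] already for [n = 0]. *)
pose d n := (b - a) / n.+3%:R.
have d0 n : 0 < d n by rewrite divr_gt0// subr_gt0.
have d3 n : d n <= (b - a) / 3.
  by rewrite ler_pM2l ?subr_gt0// lef_pV2 ?posrE// ler_nat.
have dle m n : (m <= n)%N -> d n <= d m.
  by move=> mn; rewrite ler_pM2l ?subr_gt0// lef_pV2 ?posrE// ler_nat.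
have dlim : d n @[n --> \oo] --> 0.
  rewrite -(mulr0 (b - a)); apply: cvgMr.
  by have := @cvg_harmonic R; rewrite -(cvg_shiftn 2); under eq_fun do rewrite addn2.
pose I n : set R := `[a + d n, b - d n]%classic.
have ltI n : a + d n < b - d n by have := d3 n; move: ab; lra.
have subI n x : x \in `[a + d n, b - d n] -> x \in `]a, b[.
  by rewrite !in_itv/= => /andP[? ?]; have := d0 n; lra.
have bigI : \bigcup_n I n = `]a, b[%classic.
  apply/seteqP; split => [x [n _] /subI//|x /=]; rewrite in_itv/= => /andP[ax xb].
  have e0 : 0 < Num.min (x - a) (b - x) by rewrite lt_min !subr_gt0 ax.
  have /cvgrPdist_lt/(_ _ e0)[n _ /(_ n (leqnn _))] := dlim.
  rewrite sub0r normrN ger0_norm ?ltW// lt_min => /andP[? ?].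
  by exists n; [by []|rewrite /I/= in_itv/=; apply/andP; split; lra].
have mf : measurable_fun `]a, b[ f.
  apply: open_continuous_measurable_fun => // x; rewrite inE; exact: cf.
rewrite integral_itv_bndoo; last exact/measurable_EFinP.
rewrite -bigI.
have ndI : {homo I : m n / (m <= n)%N >-> (m <= n)%O}.
  move=> m n mn; apply/subsetPset => x; rewrite /I/= !in_itv/= => /andP[? ?].
  by have := dle _ _ mn; lra.
have H : (\int[mu]_(x in I i) (f x)%:E @[i --> \oo] -->
    \int[mu]_(x in \bigcup_n I n) (f x)%:E)%E.
  apply: ge0_nondecreasing_set_cvg_integral => //.
  - by move=> n; exact: measurable_itv.
  - move=> n; apply/measurable_EFinP; apply: measurable_funS mf => //.
    by move=> x /subI.
  - by move=> n x /subI /f0; rewrite lee_fin.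
apply: cvg_unique H _; first exact: ereal_hausdorff.
have intI n : (\int[mu]_(x in I n) (f x)%:E = (F (b - d n) - F (a + d n))%:E)%E.
  rewrite EFinB; apply: continuous_FTC2 => //.
  - by apply: continuous_in_subspaceT => x; rewrite inE => /subI; exact: cf.
  - split => [x xI||]; last 2 first.
    + exact/cvg_at_right_filter/cF.
    + exact/cvg_at_left_filter/cF.
    + by apply: ex_derive; exact/dF/(subI n)/subset_itv_oo_cc.
  - move=> x /subset_itv_oo_cc/subI xI; rewrite derive1E.
    by have [_ ->] := dF x xI.
rewrite /=; under eq_cvg do rewrite intI.
apply: cvg_EFin; first exact: nearW.
rewrite /=; apply: cvgB.
  apply: (@cvg_comp _ _ _ (fun n => b - d n) F _ (nbhs b)); last exact: cF.
  by rewrite -{2}(subr0 b); apply: cvgB => //; exact: cvg_cst.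
apply: (@cvg_comp _ _ _ (fun n => a + d n) F _ (nbhs a)); last exact: cF.
by rewrite -{2}(addr0 a); apply: cvgD => //; exact: cvg_cst.
Qed.

End Calculus.

(** * Chain rule and composition of limits *)

Section Chain.
Variable R : realType.

Lemma is_derive_comp1 (f g : R -> R) (x df dg : R) :
  is_derive (g x) (1 : R) f df -> is_derive x (1 : R) g dg ->
  is_derive x (1 : R) (fun t => f (g t)) (df * dg).
Proof.
move=> [f1 f2] [g1 g2]; apply: DeriveDef.
  by apply/derivable1_diffP; apply: (@differentiable_comp _ _ _ _ g f);
    apply/derivable1_diffP.
by rewrite -derive1E (derive1_comp (f := g) (g := f))// !derive1E f2 g2.
Qed.

Lemma is_derive_onem (x : R) : is_derive x (1 : R) (fun t : R => 1 - t) (0 - 1).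
Proof. exact: (is_deriveB (is_derive_cst (1 : R) x 1) (is_derive_id x 1)). Qed.

Lemma cvg_comp_at (f g : R -> R) (x : R) :
  g t @[t --> x] --> g x -> f t @[t --> g x] --> f (g x) ->
  f (g t) @[t --> x] --> f (g x).
Proof. by move=> cg cf; exact: (cvg_comp _ _ cg cf). Qed.

End Chain.

(** * The swept area in one quadrant as an incomplete beta integral *)

Section ArcPrimitive.
Variables (R : realType) (p : R).
Hypothesis p0 : 0 < p.
Notation mu := (@lebesgue_measure R).

(* The absolute values only serve to make the functions continuous on the whole line. *)
Definition arc (y : R) : R := `|1 - `|y| `^ p| `^ p^-1.

(** The base point -1 makes 0 an interior point of the domain of integration, so the primitive is
    differentiable at 0 as well; subtracting the second integral normalises it to vanish there. *)
Definition arc_primitive (y : R) : R :=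
  (\int[mu]_(t in `[-1, y]) arc t - \int[mu]_(t in `[-1, 0]) arc t)%R.

(* The area of the part of the unit ball between the positive x-axis and the
   ray through ((1-w)^(1/p), w^(1/p)): integrate along y and remove a triangle. *)
Definition sarea (w : R) : R :=
  arc_primitive (`|w| `^ p^-1) - `|w * (1 - w)| `^ p^-1 / 2.

Let ip0 : 0 < p^-1. Proof. by rewrite invr_gt0. Qed.

Lemma continuous_arc : continuous arc.
Proof.
move=> y; apply: (@cvg_comp_at _ (fun t : R => `|t| `^ p^-1)
  (fun t : R => 1 - `|t| `^ p)).
  by apply: cvgB; [exact: cvg_cst|exact: continuous_normr_powR].
exact: continuous_normr_powR.
Qed.

Lemma arc_primitive0 : arc_primitive 0 = 0.
Proof. by rewrite /arc_primitive subrr. Qed.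

Lemma is_derive_arc_primitive (y : R) : -1 < y ->
  is_derive y (1 : R) arc_primitive (arc y).
Proof.
move=> y1; have yy : y < y + 1 by rewrite ltrDl.
have cI : mu.-integrable `[-1, (y + 1)] (EFin \o arc).
  apply: continuous_compact_integrable; first exact: segment_compact.
  by apply: continuous_subspaceT => x; exact: continuous_arc.
have [d1 d2] := continuous_FTC1_closed yy cI y1 (@continuous_arc y).
pose c := (\int[mu]_(t in `[-1, 0%R]) arc t)%R.
have H : is_derive y (1 : R) (fun x => (\int[mu]_(t in `[-1, x]) arc t)%R) (arc y).
  by apply: (DeriveDef d1); rewrite -derive1E; exact: d2.
rewrite -(subr0 (arc y)).
exact: (@is_deriveB _ _ _ _ (cst c) y 1 _ _ H (is_derive_cst c y 1)).
Qed.

Lemma continuous_arc_primitive (y : R) : -1 < y ->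
  arc_primitive t @[t --> y] --> arc_primitive y.
Proof.
move=> /is_derive_arc_primitive[d _].
by move: d => /derivable1_diffP/differentiable_continuous.
Qed.

Lemma continuous_sarea : continuous sarea.
Proof.
move=> w; apply: cvgB.
  apply: (@cvg_comp_at _ arc_primitive (fun t : R => `|t| `^ p^-1)).
    exact: continuous_normr_powR.
  by apply: continuous_arc_primitive; rewrite (lt_le_trans _ (powR_ge0 _ _)).
apply: cvgMl.
apply: (@cvg_comp_at _ (fun t : R => `|t| `^ p^-1) (fun t : R => t * (1 - t))).
  by apply: cvgM; [exact: cvg_id|apply: cvgB; [exact: cvg_cst|exact: cvg_id]].
exact: continuous_normr_powR.
Qed.

(** With (w(1-w))^(1/p-1)/p factored out, the arc contributes 1-w and the triangle (1-2w)/2; the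
    difference is the constant 1/2, which leaves an expression symmetric in w and 1-w. *)
Lemma is_derive_sarea (w : R) : 0 < w < 1 ->
  is_derive w (1 : R) sarea (p^-1 / 2 * (w * (1 - w)) `^ (p^-1 - 1)).
Proof.
move=> /andP[w0 w1]; have w1' : 0 < 1 - w by rewrite subr_gt0.
have ww : 0 < w * (1 - w) by exact: mulr_gt0.
pose q t : R := t * (1 - t).
have dq : is_derive w (1 : R) q (1 - 2 * w).
  apply: (is_derive_eq (is_deriveM (is_derive_id w (1 : R)) (is_derive_onem w))).
  rewrite /= /GRing.scale/=; ring.
have d1 := is_derive1_powR p^-1 w0.
have d2 := is_derive_comp1 (is_derive_arc_primitive _) d1.
have {}d2 := d2 (lt_le_trans (ltrN10 _) (powR_ge0 _ _)).
have d3 := @is_derive_comp1 R (fun x : R => x `^ p^-1) q w _ _ (is_derive1_powR p^-1 ww) dq.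
have d4 := is_deriveB d2 (is_deriveZ (2^-1 : R) d3).
apply: (near_eq_is_derive (f := (fun t => arc_primitive (t `^ p^-1)) -
   (2^-1 : R) \*: (fun t => q t `^ p^-1))).
  near=> t.
  have t0 : 0 < t by near: t; exact: lt_nbhsr.
  have t1 : t < 1 by near: t; exact: lt_nbhsl.
  rewrite /sarea /= fctE /= /GRing.scale/= !ger0_norm ?(ltW t0)//.
    by rewrite mulrC.
  by rewrite mulr_ge0 ?(ltW t0)// subr_ge0 ltW.
apply: (is_derive_eq d4).
have wp : (w `^ p^-1) `^ p = w by rewrite -powRrM mulVf ?gt_eqF// powRr1// ltW.
rewrite /arc !ger0_norm ?powR_ge0// wp ?ltW//.
have B (z : R) : 0 < z -> z `^ p^-1 = z * z `^ (p^-1 - 1).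
  by move=> z0; rewrite mulr_powRB1// ltW.
rewrite (B _ w1') !powRM ?ltW// /GRing.scale/=; field.
by rewrite gt_eqF.
Unshelve. all: by end_near. Qed.

Lemma sarea0 : sarea 0 = 0.
Proof.
by rewrite /sarea mul0r normr0 powR0 ?gt_eqF// arc_primitive0 mul0r subr0.
Qed.

Lemma sarea1 : sarea 1 = arc_primitive 1.
Proof.
by rewrite /sarea subrr mulr0 normr0 powR0 ?gt_eqF// mul0r subr0 normr1 powR1.
Qed.

Lemma sarea_lt (x y : R) : 0 <= x -> x < y -> y <= 1 -> sarea x < sarea y.
Proof.
move=> x0 xy y1; apply: (gtr0_derive1_lt_cc (a := 0) (b := 1)) => //.
- by move=> z; rewrite in_itv/= => /is_derive_sarea [].
- move=> z; rewrite in_itv/= => z01; have [_] := is_derive_sarea z01.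
  rewrite derive1E => ->; move: z01 => /andP[z0 z1].
  by rewrite mulr_gt0 ?divr_gt0// powR_gt0// mulr_gt0// subr_gt0.
- by apply: continuous_subspaceT => t; exact: continuous_sarea.
- by rewrite in_itv/= x0 ltW// (lt_le_trans xy).
- by rewrite in_itv/= y1 ltW// (le_lt_trans x0).
Qed.

(** The symmetry of the derivative makes [h] constant. Geometrically, reflection in the diagonal
    exchanges the two parts of the quadrant. *)
Lemma sarea_onem (w : R) : 0 <= w <= 1 -> sarea w + sarea (1 - w) = sarea 1.
Proof.
pose h t := sarea t + sarea (1 - t).
have ch : {within `[0, 1], continuous h}.
  apply: continuous_subspaceT => t; apply: cvgD; first exact: continuous_sarea.
  apply: (@cvg_comp_at _ sarea (fun t : R => 1 - t)).
    by apply: cvgB; [exact: cvg_cst|exact: cvg_id].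
  exact: continuous_sarea.
have dh (z : R) : z \in `]0%R, 1%R[ -> is_derive z (1 : R) h 0.
  rewrite in_itv/= => z01.
  have z01' : 0 < 1 - z < 1 by move: z01; lra.
  have d1 := is_derive_sarea z01.
  have d2 := @is_derive_comp1 R sarea (fun t => 1 - t) z _ _
    (is_derive_sarea z01') (is_derive_onem z).
  apply: (is_derive_eq (is_deriveD d1 d2)).
  by rewrite (_ : 1 - (1 - z) = z) ?(mulrC (1 - z)); [ring|ring].
move=> /andP[w0 w1].
have -> : sarea 1 = h 0 by rewrite /h subr0 sarea0 add0r.
rewrite -/(h w); move: w0; rewrite le_eqVlt => /predU1P[<-//|w0].
have [||c _] := @MVT _ h (cst 0) 0 w w0.
- move=> z; rewrite in_itv/= => /andP[z0 zw]; apply: dh.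
  by rewrite in_itv/= z0 (lt_le_trans zw).
- by apply: continuous_subspaceW ch; apply: subset_itvl; rewrite bnd_simp.
by rewrite /= mul0r => /eqP; rewrite subr_eq0 => /eqP.
Qed.

(** [W] inverts t = 4w(1-w) on the branch w <= 1/2; the other branch is reached later through
    [sarea_onem]. The constant [k] cancels the factor 1/(2p) of the derivative of [sarea] and the
    power of 4 coming from w(1-w) = t/4. *)
Lemma incB_sarea (x : R) : 0 <= x <= 1 ->
  incB x p^-1 2^-1 = 2 * p * 4 `^ p^-1 * sarea ((1 - `|1 - x| `^ 2^-1) / 2).
Proof.
pose W (t : R) := (1 - `|1 - t| `^ 2^-1) / 2.
pose k := 2 * p * 4 `^ p^-1.
pose G t := k * sarea (W t).
have cW : continuous W.
  move=> t; apply: cvgMl; apply: cvgB; first exact: cvg_cst.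
  apply: (@cvg_comp_at _ (fun t : R => `|t| `^ 2^-1) (fun t : R => 1 - t)).
    by apply: cvgB; [exact: cvg_cst|exact: cvg_id].
  by apply: continuous_normr_powR; rewrite invr_gt0.
have cG : continuous G.
  move=> t; apply: cvgMr; apply: (@cvg_comp_at _ sarea W) => //.
    exact: cW.
  exact: continuous_sarea.
pose f (t : R) := t `^ (p^-1 - 1) * (1 - t) `^ (2^-1 - 1).
have dG (t : R) : 0 < t < 1 -> is_derive t (1 : R) G (f t).
  move=> /andP[t0 t1]; have t1' : 0 < 1 - t by rewrite subr_gt0.
  have d1 := @is_derive_comp1 R (fun x : R => x `^ 2^-1) (fun t => 1 - t) t _ _
    (is_derive1_powR 2^-1 t1') (is_derive_onem t).
  have d2 := is_deriveZ (2^-1 : R) (is_deriveB (is_derive_cst (1 : R) t 1) d1).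
  have dW : is_derive t (1 : R) W (4^-1 * (1 - t) `^ (2^-1 - 1)).
    apply: near_eq_is_derive; last first.
      by apply: (is_derive_eq d2); rewrite /GRing.scale/=; field.
    near=> s; have s1 : s < 1 by near: s; exact: lt_nbhsl.
    by rewrite /W/= fctE /= /GRing.scale/= ger0_norm ?subr_ge0 ?ltW// mulrC.
  pose s := (1 - t) `^ 2^-1.
  have s0 : 0 < s by exact: powR_gt0.
  have ss : s * s = 1 - t.
    by rewrite -expr2 -powR_mulrn ?ltW// -powRrM mulVf// powRr1// ltW.
  have s1 : s < 1 by nra.
  have WE : W t = (1 - s) / 2 by rewrite /W ger0_norm// ltW.
  have W01 : 0 < W t < 1 by rewrite WE; lra.
  have d3 := is_deriveZ k (@is_derive_comp1 R sarea W t _ _ (is_derive_sarea W01) dW).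
  apply: (is_derive_eq d3).
  have -> : W t * (1 - W t) = t / 4.
    rewrite WE (_ : _ * _ = (1 - s * s) / 4); last by field.
    by rewrite ss; field.
  rewrite /f /GRing.scale/= powRM ?invr_ge0 ?(ltW t0)//.
  have -> : (4^-1 : R) `^ (p^-1 - 1) = 4 / 4 `^ p^-1.
    by rewrite -powR_inv1// -powRrM mulN1r opprB powRD ?powRr1 ?powRN ?pnatr_eq0 ?implybT.
  have k0 : (4 : R) `^ p^-1 != 0 by rewrite gt_eqF// powR_gt0.
  by rewrite /k; field; rewrite k0 gt_eqF.
move=> /andP[x0 x1]; rewrite /incB.
have G0 : G 0 = 0.
  by rewrite /G /W subr0 normr1 powR1 subrr mul0r sarea0 mulr0.
move: x0; rewrite le_eqVlt => /predU1P[<-|x0].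
  by rewrite set_itv1 integral_set1 -/(W 0) -/k -/(G 0) G0.
have sub (t : R) : t \in `]0%R, x[ -> 0 < t < 1.
  by rewrite in_itv/= => /andP[-> tx]; rewrite (lt_le_trans tx).
rewrite (@ge0_FTC2 _ f G 0 x x0); first by rewrite G0 subr0.
- by move=> t _; rewrite mulr_ge0// powR_ge0.
- move=> t /sub/andP[t0 t1]; apply: cvgM; first exact: continuous_powR_gt0.
  apply: (@cvg_comp_at _ (fun t : R => t `^ (2^-1 - 1)) (fun t : R => 1 - t)).
    by apply: cvgB; [exact: cvg_cst|exact: cvg_id].
  by apply: continuous_powR_gt0; rewrite subr_gt0.
- by move=> t /sub; exact: dG.
- exact: cG.
Unshelve. all: by end_near. Qed.

End ArcPrimitive.

(** * Measurability of exponentials and powers *)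

Section MeasurableComp.
Context d (T : measurableType d) (R : realType).
Implicit Types (D : set T) (f : T -> R).

Lemma measurable_expRN_comp D f :
  measurable_fun D f -> measurable_fun D (fun x => expR (- f x)).
Proof.
move=> mf; apply: (@measurableT_comp _ _ _ _ _ _ (@expR R) D (fun x => - f x)) => //.
exact: (@measurableT_comp _ _ _ _ _ _ (@GRing.opp R) D f).
Qed.

Lemma measurable_powR_comp D f (r : R) :
  measurable_fun D f -> measurable_fun D (fun x => f x `^ r).
Proof.
move=> mf.
exact: (@measurableT_comp _ _ _ _ _ _ (fun t : R => t `^ r) D f (measurable_powR r)).
Qed.

End MeasurableComp.

(** * The area of a quadrant in terms of the Gamma function *)

Section GammaBeta.
Variables (R : realType) (p : R).
Hypothesis p0 : 0 < p.
Notation mu := (@lebesgue_measure R).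

Let ip0 : 0 < p^-1. Proof. by rewrite invr_gt0. Qed.

Lemma integral_indicr (D : set R) (f : R -> R) :
  (\int[mu]_(x in D) (f x)%:E = \int[mu]_x (f x * \1_D x)%:E)%E.
Proof.
rewrite integral_mkcond; apply: eq_integral => x _.
by rewrite patchE indicE; case: ifP => _; rewrite ?mulr1 ?mulr0.
Qed.

Lemma indic_itvcy (a y : R) : \1_(`[a, +oo[%classic) y = (a <= y)%R%:R :> R.
Proof. by rewrite indicE mem_setE in_itv/= andbT. Qed.

Lemma powR_le_inv (y c : R) : 0 <= y -> 0 <= c -> (y `^ p <= c) = (y <= c `^ p^-1).
Proof.
move=> y0 c0; apply/idP/idP => h.
  have -> : y = (y `^ p) `^ p^-1 by rewrite -powRrM mulfV ?gt_eqF// powRr1.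
  by apply: ge0_ler_powR; rewrite ?nnegrE ?powR_ge0// ltW.
have -> : c = (c `^ p^-1) `^ p by rewrite -powRrM mulVf ?gt_eqF// powRr1.
by apply: ge0_ler_powR; rewrite ?nnegrE ?powR_ge0// ltW.
Qed.

Lemma integral_expRN_tail (k u : R) : 0 < k ->
  (\int[mu]_(t in `[u, +oo[) (expR (- (k * t)))%:E = (expR (- (k * u)) / k)%:E)%E.
Proof.
move=> k0; have ce : continuous (fun t : R => expR (- (k * t))).
  move=> t; apply: (@cvg_comp_at _ expR (fun t : R => - (k * t))).
    by apply: cvgN; apply: cvgMr; exact: cvg_id.
  exact: continuous_expR.
pose F (t : R) := (- k^-1) * expR (- (k * t)).
have dF (t : R) : is_derive t (1 : R) F (expR (- (k * t))).
  have d0 := is_deriveN (is_deriveZ k (is_derive_id t (1 : R))).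
  have d1 := @is_derive_comp1 R expR (fun t => - (k * t)) t _ _ (is_derive_expR _) d0.
  apply: (is_derive_eq (is_deriveZ (- k^-1) d1)).
  by rewrite /GRing.scale/=; field; rewrite gt_eqF.
have cF : continuous F by move=> t; apply: cvgMr; exact: ce.
rewrite (@ge0_continuous_FTC2y _ _ F u 0).
- by rewrite sub0e -EFinN /F mulNr opprK mulrC.
- by move=> t _; exact: expR_ge0.
- by apply: continuous_subspaceT => t; exact: ce.
- rewrite -(mulr0 (- k^-1)); apply: cvgMr.
  apply: (@cvg_comp _ _ _ (fun t : R => k * t) (fun t => expR (- t)) _ (@pinfty_nbhs R)).
    by apply: gt0_cvgMry => //; exact: cvg_id.
  exact: cvgr_expR.
- by move=> t _; have [] := dF t.
- exact/cvg_at_right_filter/cF.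
- by move=> t _; rewrite derive1E; have [_ ->] := dF t.
Qed.

(** The first coordinate is the space variable, the second the layer variable t of the slicing;
    integrating over this region in either order is what Tonelli compares. *)
Definition subgraph (u : R) : set (R * R) :=
  [set z | 0 <= z.1 /\ u + z.1 `^ p <= z.2].

Lemma measurable_powR_fst (u : R) :
  measurable_fun [set: R * R] (fun z : R * R => u + z.1 `^ p).
Proof.
apply: measurable_funD; first exact: measurable_cst.
exact: (measurable_powR_comp p measurable_fst).
Qed.

Lemma measurable_subgraph (u : R) : measurable (subgraph u).
Proof.
rewrite (_ : subgraph u = (setT `&` [set z : R * R | 0 <= z.1]) `&`
    (setT `&` [set z : R * R | u + z.1 `^ p <= z.2])); last first.
  by apply/seteqP; split => [z []|z [[_ ?] [_ ?]]].
apply: measurableI; apply: measurable_fun_le => //.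
exact: measurable_powR_fst.
Qed.

Lemma measurable_expRN_snd : measurable_fun [set: R * R] (fun z : R * R => expR (- z.2)).
Proof.
exact: (measurable_expRN_comp measurable_snd).
Qed.

(* Layer cake: exp(-(u+y^p)) is the integral of exp(-t) over t >= u+y^p. *)
Lemma integral_expRN_powR (u : R) : 0 <= u ->
  (\int[mu]_(y in `[0%R, +oo[) (expR (- (u + y `^ p)))%:E =
   \int[mu]_(t in `[u, +oo[) (expR (- t) * (t - u) `^ p^-1)%:E)%E.
Proof.
move=> u0; rewrite integral_indicr [RHS]integral_indicr.
pose f (z : R * R) := (expR (- z.2) * \1_(subgraph u) z)%:E.
have mf : measurable_fun setT f.
  apply/measurable_EFinP/measurable_funM; first exact: measurable_expRN_snd.
  by apply: measurable_indic; exact: measurable_subgraph.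
have f0 z : (0 <= f z)%E by rewrite lee_fin mulr_ge0 ?expR_ge0.
transitivity (\int[mu]_y \int[mu]_t f (y, t))%E.
  apply: eq_integral => y _; rewrite /f /=.
  rewrite indic_itvcy.
  have [y0|y0] := boolP (0 <= y); last first.
    rewrite mulr0 integral0_eq// => t _; rewrite indicE memNset ?mulr0//.
    by move=> [/= h]; rewrite h in y0.
  rewrite mulr1; under eq_integral => t _.
    rewrite (_ : \1_(subgraph u) (y, t) = \1_(`[u + y `^ p, +oo[%classic) t :> R); last first.
      rewrite indic_itvcy indicE; congr (_ %:R); congr nat_of_bool.
      by apply/idP/idP; rewrite inE /subgraph/=; [case|split].
    over.
  rewrite -integral_indicr.
  have := integral_expRN_tail (u + y `^ p) ltr01.
  by under eq_integral do rewrite mul1r; rewrite mul1r divr1 => ->.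
transitivity (\int[mu]_t \int[mu]_y f (y, t))%E; first exact: fubini_tonelli.
apply: eq_integral => t _.
rewrite /f /=; under eq_integral do rewrite EFinM.
rewrite ge0_integralZl_EFin ?expR_ge0//; last first.
  apply/measurable_EFinP.
  exact: (measurableT_comp (measurable_indic (measurable_subgraph u)) (measurable_pair2 t)).
rewrite -mulrA EFinM; congr (_ * _)%E.
rewrite indic_itvcy.
have [ut|ut] := boolP (u <= t); last first.
  rewrite mulr0 integral0_eq// => y _; rewrite indicE memNset//.
  move=> [/= _ h]; move: ut; rewrite -ltNge => ut.
  by have := powR_ge0 y p; lra.
rewrite mulr1; transitivity (\int[mu]_x (\1_(`[0%R, (t - u) `^ p^-1]%classic) x)%:E)%E.
  apply: eq_integral => y _; congr EFin; rewrite !indicE; congr (_ %:R); congr nat_of_bool.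
  have tu : 0 <= t - u by rewrite subr_ge0.
  apply/idP/idP; rewrite !inE /subgraph/= in_itv/= -lerBrDl.
    by move=> [y0 h]; rewrite y0 -powR_le_inv.
  by move=> /andP[y0 h]; rewrite y0 powR_le_inv.
rewrite integral_indic//= setIT lebesgue_measure_itv/= lte_fin.
case: ltP => [_|]; first by rewrite sube0.
by rewrite le_eqVlt ltNge powR_ge0 orbF => /eqP ->.
Qed.

(** The integral is the area of the quadrant x^p + y^p <= t, which is the unit quadrant scaled by
    [c] in both directions; hence the factor c^2 = t^(2/p). *)
Lemma integral_ball_section (t : R) : 0 < t ->
  (\int[mu]_(x in `[0%R, (t `^ p^-1)%R]) ((t - x `^ p) `^ p^-1)%R%:E =
   (t `^ (p^-1 + p^-1) * sarea p 1)%R%:E)%E.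
Proof.
move=> t0; pose c := t `^ p^-1.
have c0 : 0 < c by exact: powR_gt0.
have cp : c `^ p = t by rewrite -powRrM mulVf ?gt_eqF// powRr1// ltW.
pose F (x : R) := c ^+ 2 * arc_primitive p (`|x| / c).
have cF : continuous F.
  move=> x; apply: cvgMr.
  apply: (@cvg_comp_at _ (arc_primitive p) (fun x : R => `|x| / c)).
    by apply: cvgMl; exact: norm_continuous.
  apply: continuous_arc_primitive => //.
  by rewrite (lt_le_trans (ltrN10 _))// divr_ge0// ltW.
have dF (x : R) : x \in `]0%R, c[ -> is_derive x (1 : R) F ((t - x `^ p) `^ p^-1).
  rewrite in_itv/= => /andP[x0 xc].
  have xc1 : -1 < x / c by rewrite (lt_trans (ltrN10 _))// divr_gt0.
  have d0 : is_derive x (1 : R) (fun x : R => x / c) (c^-1).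
    apply: (near_eq_is_derive (f := c^-1 \*: id)).
      by near=> s; rewrite /= /GRing.scale/= mulrC.
    apply: (is_derive_eq (is_deriveZ c^-1 (is_derive_id x (1 : R)))).
    by rewrite /GRing.scale/= mulr1.
  have d1 := @is_derive_comp1 R (arc_primitive p) (fun x => x / c) x _ _
    (is_derive_arc_primitive p0 xc1) d0.
  apply: (near_eq_is_derive (f := c ^+ 2 \*: (fun x : R => arc_primitive p (x / c)))).
    near=> s; rewrite /F ger0_norm// ltW//; near: s; exact: lt_nbhsr.
  apply: (is_derive_eq (is_deriveZ (c ^+ 2) d1)).
  have xp : x `^ p < t by rewrite -cp gt0_ltr_powR// nnegrE ltW.
  have xcp : (x / c) `^ p = x `^ p / t.
    by rewrite powRM ?invr_ge0 ?ltW// -powR_inv1 ?ltW// powRAC cp powR_inv1// ltW.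
  rewrite /arc (ger0_norm (_ : 0 <= x / c)) ?divr_ge0 ?ltW// xcp.
  have h : 0 <= 1 - x `^ p / t by rewrite subr_ge0 ler_pdivrMr// mul1r ltW.
  rewrite ger0_norm// /GRing.scale/=.
  rewrite (_ : t - x `^ p = t * (1 - x `^ p / t)); last by field; rewrite gt_eqF.
  by rewrite (powRM _ (ltW t0) h) -/c; field; rewrite gt_eqF.
rewrite (ge0_FTC2 c0 _ _ dF cF).
- rewrite /F normr0 mul0r arc_primitive0 mulr0 subr0 gtr0_norm// divff ?gt_eqF//.
  by rewrite sarea1// powRD -/c ?expr2// (gt_eqF t0) implybT.
- by move=> x _; exact: powR_ge0.
- move=> x; rewrite in_itv/= => /andP[x0 xc].
  apply: (@cvg_comp_at _ (fun s : R => s `^ p^-1) (fun x : R => t - x `^ p)).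
    by apply: cvgB; [exact: cvg_cst|exact: continuous_powR_gt0].
  by apply: continuous_powR_gt0; rewrite subr_gt0 -cp gt0_ltr_powR// nnegrE ltW.
Unshelve. all: by end_near. Qed.

Lemma sarea1_gt0 : 0 < sarea p 1.
Proof. by rewrite -(sarea0 p0) (sarea_lt p0). Qed.

(** Both sides are J^2, where J is the integral of exp(-x^p) over the half-line. Positivity is
    carried along to allow the later division by [Gamma (1 + 2 / p)]. *)
Lemma sarea_Gamma : sarea p 1 * Gamma (1 + 2 / p) = Gamma (1 + p^-1) ^+ 2 /\
  0 < Gamma (1 + 2 / p).
Proof.
pose J := (\int[mu]_(y in `[0%R, +oo[) (expR (- (y `^ p)))%:E)%E.
have JE : J = (\int[mu]_(t in `[0%R, +oo[) (t `^ p^-1 * expR (- t))%:E)%E.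
  have := integral_expRN_powR (lexx 0).
  under eq_integral do rewrite add0r.
  under [in X in _ = X -> _]eq_integral do rewrite subr0 mulrC.
  by [].
have GJ : Gamma (1 + p^-1) = fine J by rewrite /Gamma JE addrAC subrr add0r.
have mexp : measurable_fun setT (fun y : R => (expR (- (y `^ p)))%:E).
  apply/measurable_EFinP/measurable_expRN_comp; exact: measurable_powR.
have J0 : (0 < J)%E.
  apply: (@lt_le_trans _ _ (\int[mu]_(y in `[0%R, 1%R]) (expR (- 1))%:E)%E).
    rewrite integral_cst//= lebesgue_measure_itv/= lte01 oppr0 adde0 mule1.
    by rewrite lte_fin expR_gt0.
  apply: (@le_trans _ _ (\int[mu]_(y in `[0%R, 1%R]) (expR (- (y `^ p)))%:E)%E).
    apply: ge0_le_integral => //.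
    - exact: measurable_funTS mexp.
    - move=> y /=; rewrite in_itv/= => /andP[y0 y1].
      by rewrite lee_fin ler_expR lerN2 powR_le_inv ?powR1.
  apply: ge0_subset_integral => //.
  - exact: measurable_funTS mexp.
  - by move=> y /=; rewrite !in_itv/= => /andP[->].
have Joo : (J < +oo)%E.
  (* This [k] turns t <= k exp(t/k) into t^(1/p) <= k^(1/p) exp(t/2), which leaves an integrable
     exp(-t/2). *)
  pose k := 2 / p; have k0 : 0 < k by rewrite divr_gt0.
  have bnd (t : R) : 0 <= t -> t `^ p^-1 * expR (- t) <= k `^ p^-1 * expR (- (2^-1 * t)).
    move=> t0.
    have tk : t <= k * expR (t / k).
      rewrite -ler_pdivrMl// mulrC.
      by apply: le_trans (expR_ge1Dx _); rewrite lerDr.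
    have : t `^ p^-1 <= k `^ p^-1 * expR (t / 2).
      apply: le_trans (_ : (k * expR (t / k)) `^ p^-1 <= _).
        by apply: ge0_ler_powR; rewrite ?nnegrE ?mulr_ge0 ?expR_ge0// ltW.
      rewrite powRM ?expR_ge0 ?(ltW k0)// -expRM /k.
      by rewrite (_ : t / (2 / p) * p^-1 = t / 2)//; field; rewrite gt_eqF.
    rewrite (_ : _ * expR (- (2^-1 * t)) = k `^ p^-1 * expR (t / 2) * expR (- t)).
      by move=> h; rewrite ler_wpM2r ?expR_ge0.
    by rewrite -mulrA -expRD; congr (_ * expR _); field.
  apply: (@le_lt_trans _ _ (\int[mu]_(t in `[0%R, +oo[) (k `^ p^-1 * expR (- (2^-1 * t)))%:E)%E).
    rewrite JE; apply: ge0_le_integral => //.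
    - by move=> t _; rewrite lee_fin mulr_ge0 ?powR_ge0 ?expR_ge0.
    - apply/measurable_EFinP/measurable_funM.
        by apply: measurable_funTS; exact: measurable_powR.
      exact: measurable_expRN_comp.
    - apply/measurable_EFinP/measurable_funM; first exact: measurable_cst.
      by apply: measurable_expRN_comp; apply: measurable_funM.
    - by move=> t /=; rewrite in_itv/= andbT => /bnd; rewrite lee_fin.
  under eq_integral do rewrite EFinM.
  rewrite ge0_integralZl_EFin ?powR_ge0//; last first.
    apply/measurable_EFinP.
      by apply: measurable_expRN_comp; apply: measurable_funM.
  by rewrite integral_expRN_tail ?invr_gt0// -EFinM ltry.
have Jfin : J \is a fin_num by rewrite ge0_fin_numE// ltW.
(* Here y is already integrated out: for fixed x and t, the power (t - x^p)^(1/p) is the length of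
   the range of y with x^p + y^p <= t. *)
pose g (z : R * R) := (expR (- z.2) * `|z.2 - z.1 `^ p| `^ p^-1 * \1_(subgraph 0) z)%:E.
have mg : measurable_fun setT g.
  apply/measurable_EFinP/measurable_funM; last first.
    by apply: measurable_indic; exact: measurable_subgraph.
  apply: measurable_funM; first exact: measurable_expRN_snd.
  apply: measurable_powR_comp; apply: measurableT_comp => //.
  apply: measurable_funB; first exact: measurable_snd.
  exact: (measurable_powR_comp p measurable_fst).
have g0 z : (0 <= g z)%E by rewrite lee_fin !mulr_ge0 ?expR_ge0 ?powR_ge0.
have JJ : (J * J = \int[mu]_x \int[mu]_t g (x, t))%E.
  transitivity (\int[mu]_(x in `[0%R, +oo[) ((expR (- (x `^ p)))%:E * J))%E.
    rewrite ge0_integralZr//; first exact: measurable_funTS mexp.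
    exact: ltW.
  rewrite integral_mkcond; apply: eq_integral => x _; rewrite patchE mem_setE in_itv/= andbT.
  case: ifPn => x0; last first.
    rewrite integral0_eq// => t _; rewrite /g indicE memNset ?mulr0//.
    by move=> [/= h]; rewrite h in x0.
  rewrite -ge0_integralZl_EFin ?expR_ge0//; last first.
    exact: measurable_funTS mexp.
  under eq_integral do rewrite -EFinM -expRD -opprD.
  rewrite integral_expRN_powR ?powR_ge0// integral_indicr.
  apply: eq_integral => t _; rewrite /g /= indic_itvcy indicE.
  have [xt|xt] := boolP (x `^ p <= t).
    by rewrite ger0_norm ?subr_ge0// mem_set//= /subgraph/= add0r x0.
  by rewrite memNset ?mulr0// /subgraph/= add0r => -[_ h]; rewrite h in xt.
have JJ' : (J * J = \int[mu]_t ((sarea p 1)%:E *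
    (expR (- t) * t `^ (p^-1 + p^-1) * \1_(`[0%R, +oo[%classic) t)%:E))%E.
  rewrite JJ; transitivity (\int[mu]_t \int[mu]_x g (x, t))%E.
    exact: fubini_tonelli.
  have subE (x t : R) : 0 <= t ->
      ((x, t) \in subgraph 0) = (x \in `[0, t `^ p^-1]).
    move=> t0; rewrite in_itv/=; apply/idP/idP; rewrite inE /subgraph/= add0r.
      by move=> [x0]; rewrite powR_le_inv// x0.
    by move=> /andP[x0 xt]; rewrite powR_le_inv.
  have Nsub (x t : R) : t <= 0 -> x != 0 -> \1_(subgraph 0) (x, t) = 0 :> R.
    move=> t0 x0; rewrite indicE memNset// => -[/= x0' h]; move: h.
    by rewrite leNgt add0r (le_lt_trans t0)// powR_gt0// lt_neqAle eq_sym x0.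
  apply: eq_integral => t _; rewrite indic_itvcy.
  have [t0|t0] := ltP 0 t; last first.
    rewrite (_ : _ * _ = 0)%E; last first.
      move: t0; rewrite le_eqVlt => /predU1P[->|t0].
        by rewrite powR0 ?mulr0 ?mul0r ?mule0// gt_eqF// addr_gt0.
      by rewrite leNgt t0 mulr0 mule0.
    (* For [t <= 0] the slice of [subgraph 0] contains at most the point x = 0, a null set. *)
    transitivity (\int[mu]_(x in ~` [set 0%R]) g (x, t))%E.
      rewrite -[in RHS]setTD integral_setD1//.
        by apply: measurableD => //; exact: measurable_set1.
      apply: measurable_funTS.
      exact: (measurableT_comp mg (measurable_pair2 t)).
    by apply: integral0_eq => x /= /eqP x0; rewrite /g Nsub// mulr0.
  rewrite (ltW t0) mulr1 -EFinM mulrCA.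
  rewrite [X in (_ * X)%:E]mulrC EFinM -integral_ball_section//.
  rewrite -ge0_integralZl_EFin ?expR_ge0//; last first.
    apply/measurable_EFinP/measurable_powR_comp; apply: measurable_funB => //.
    by apply: measurable_funTS; exact: measurable_powR.
    by move=> x _; rewrite lee_fin powR_ge0.
  rewrite [RHS]integral_mkcond; apply: eq_integral => x _.
  rewrite patchE mem_setE /g indicE subE ?(ltW t0)//; case: ifPn => [|_]; last by rewrite mulr0.
  rewrite in_itv/= => /andP[x0 xt]; rewrite mulr1 ger0_norm -?EFinM//.
  by rewrite subr_ge0 powR_le_inv// ltW.
have K0 : 0 <= sarea p 1 by exact/ltW/sarea1_gt0.
pose L := (\int[mu]_(t in `[0%R, +oo[) (t `^ (p^-1 + p^-1) * expR (- t))%:E)%E.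
have GL : Gamma (1 + 2 / p) = fine L.
  rewrite /Gamma /L addrAC subrr add0r.
  by congr fine; apply: eq_integral => t _; congr ((_ `^ _ * _)%:E); field; rewrite gt_eqF.
have LE : (J * J = (sarea p 1)%:E * L)%E.
  rewrite JJ' ge0_integralZl_EFin//; last 2 first.
  - by move=> t _; rewrite lee_fin !mulr_ge0 ?expR_ge0 ?powR_ge0.
  - apply/measurable_EFinP/measurable_funM; last exact: measurable_indic.
    by apply: measurable_funM; [exact: measurable_expRN_comp|exact: measurable_powR].
  by rewrite -integral_indicr; under eq_integral do rewrite mulrC.
have J0' : 0 < fine J by rewrite fine_gt0// J0.
(* Since [sarea p 1] is positive, an infinite [L] would make [J * J] infinite. *)
have Lfin : L \is a fin_num.
  have L0 : (0 <= L)%E.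
    by apply: integral_ge0 => t _; rewrite lee_fin mulr_ge0 ?expR_ge0 ?powR_ge0.
  rewrite ge0_fin_numE// ltey; apply/eqP => Loo; move: LE.
  by rewrite Loo gt0_muley ?lte_fin ?sarea1_gt0// -(fineK Jfin) -EFinM.
have LE' : fine J * fine J = sarea p 1 * fine L.
  by apply: EFin_inj; rewrite !EFinM !fineK.
rewrite GJ GL expr2 LE'; split=> //.
by rewrite -(pmulr_rgt0 _ sarea1_gt0) -LE' mulr_gt0.
Qed.

Lemma Sp_sarea : Sp p = 4 * sarea p 1.
Proof.
have [h g0] := sarea_Gamma.
by rewrite /Sp -h mulrA mulfK ?gt_eqF.
Qed.

End GammaBeta.

(** * Plane area: quarter turns and horizontal slicing *)

Section PlaneArea.
Variable R : realType.
Notation mu := (@lebesgue_measure R).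
Notation mu2 := (mu \x mu)%E.
Notation T := (measurableTypeR R * measurableTypeR R)%type.

(* Rotation by -pi/2: preimages under it are rotated by +pi/2. *)
Definition rotN (z : R * R) : R * R := (z.2, - z.1).

Lemma measurable_rotN : measurable_fun [set: R * R] rotN.
Proof.
apply: measurable_fun_pair; first exact: measurable_snd.
exact: (@measurableT_comp _ _ _ _ _ _ (@GRing.opp R) setT fst _ measurable_fst).
Qed.

HB.instance Definition _ :=
  @isMeasurableFun.Build _ _ T T (rotN : T -> T) measurable_rotN.

Lemma measurable_preimage_rotN (S : set (R * R)) :
  measurable S -> measurable (rotN @^-1` S).
Proof. by move=> mS; rewrite -[X in measurable X]setTI; exact: measurable_rotN. Qed.

(** By uniqueness of the product measure only rectangles matter; there the turn swaps the factors
    and reflects one of them, and Lebesgue measure is invariant under reflection. *)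
Lemma area_rotN (S : set (R * R)) : measurable S -> area (rotN @^-1` S) = area S.
Proof.
move=> mS; rewrite /area.
rewrite (@product_measure_unique _ _ _ _ _ mu mu (pushforward mu2 (rotN : T -> T)) _ _ mS)//.
move=> A B mA mB.
transitivity (mu2 (((-%R : _ -> measurableTypeR R) @^-1` B) `*` A)).
  by congr (mu2 _); apply/seteqP; split => -[x y] [].
rewrite product_measure1E//.
  by rewrite muleC; congr (_ * _)%E; exact: lebesgue_measureN mB.
rewrite -[X in measurable X]setTI.
have : measurable_fun setT (@GRing.opp R) by [].
exact.
Qed.

Lemma area_set1 (z : R * R) : area [set z] = 0%E.
Proof.
rewrite /area (_ : [set z] = [set z.1] `*` [set z.2]).
  transitivity (mu [set z.1] * mu [set z.2])%E; last first.
    by rewrite !lebesgue_measure_set1 mul0e.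
  by apply: product_measure1E; exact: measurable_set1.
by apply/seteqP; split => [_ ->//|[x y] /= [-> ->]]; case: z.
Qed.

Lemma measurable_set1_pair (z : R * R) : measurable [set z].
Proof.
rewrite (_ : [set z] = [set z.1] `*` [set z.2]).
  by apply: measurableX; exact: measurable_set1.
by apply/seteqP; split => [_ ->//|[x y] /= [-> ->]]; case: z.
Qed.

Lemma areaU (A B : set (R * R)) : measurable A -> measurable B ->
  A `&` B = set0 -> area (A `|` B) = (area A + area B)%E.
Proof. by move=> mA mB AB; rewrite /area measureU. Qed.

(** The slices are taken at constant y because [arc_primitive] integrates along y. *)
Lemma area_ysection (A : set (R * R)) : measurable A ->
  (area A = \int[mu]_y mu (ysection A y))%E.
Proof.
move=> mA; rewrite /area.
rewrite (@product_measure_unique _ _ _ _ _ mu mu (mu \x^ mu)%E _ _ mA)//.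
by move=> *; exact: product_measure2E.
Qed.

End PlaneArea.

(** * Areas of wedges and of the whole ball *)

Section BallArea.
Variables (R : realType) (p : R).
Hypothesis p0 : 0 < p.
Notation mu := (@lebesgue_measure R).

Let ip0 : 0 < p^-1. Proof. by rewrite invr_gt0. Qed.

(** The cross-product inequality places z below the ray through (c, s) without dividing, so c = 0
    gives the full quadrant. The strict condition removes the y-axis and the origin, so that quarter
    turns of [wedge 0 1] are disjoint. *)
Definition wedge (c s : R) : set (R * R) :=
  [set z | [/\ 0 < z.1, 0 <= z.2, z.2 * c <= z.1 * s & pball p z]].

Lemma measurable_fun_pnorm :
  measurable_fun [set: R * R] (fun z : R * R => `|z.1| `^ p + `|z.2| `^ p).
Proof.
by apply: measurable_funD; apply: measurable_powR_comp; apply: measurableT_comp.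
Qed.

Lemma measurable_pball : measurable (pball p).
Proof.
rewrite -[pball p]setTI; apply: measurable_fun_le => //.
exact: measurable_fun_pnorm.
Qed.

Lemma measurable_wedge (c s : R) : measurable (wedge c s).
Proof.
have -> : wedge c s = ((setT `\` (setT `&` [set z : R * R | z.1 <= 0])) `&`
    (setT `&` [set z : R * R | 0 <= z.2])) `&`
    ((setT `&` [set z : R * R | z.2 * c <= z.1 * s]) `&` pball p).
  apply/seteqP; split => [z [z1 z2 zcs zp]|z [[[_ z1] [_ z2]] [[_ zcs] zp]]].
    by do 2 split => //; split => // -[_ /=]; rewrite leNgt z1.
  by split => //; rewrite ltNge; apply/negP => h; apply: z1.
apply: measurableI; apply: measurableI; last exact: measurable_pball.
- by apply: measurableD => //; apply: measurable_fun_le.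
- exact: measurable_fun_le.
- by apply: measurable_fun_le => //; apply: measurable_funM.
Qed.

Lemma wedgeZ (r c s : R) : 0 < r -> wedge (r * c) (r * s) = wedge c s.
Proof.
move=> r0; apply/seteqP; split => z [z1 z2 h zp]; split => //; move: h;
  by rewrite mulrCA (mulrCA _ r) ler_pM2l.
Qed.

(** The slice at height y <= s runs from the line x = (c/s)y to the arc. Integrating the arc gives
    the primitive, integrating the line gives the triangle cs/2. *)
Lemma area_wedge (w : R) : 0 <= w <= 1 ->
  area (wedge ((1 - w) `^ p^-1) (w `^ p^-1)) = (sarea p w)%:E.
Proof.
move=> /andP[w0 w1]; set c := (1 - w) `^ p^-1; set s := w `^ p^-1.
have w1' : 0 <= 1 - w by rewrite subr_ge0.
have c0 : 0 <= c by exact: powR_ge0.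
have s0 : 0 <= s by exact: powR_ge0.
have cp : c `^ p = 1 - w by rewrite -powRrM mulVf ?gt_eqF// powRr1.
have sp : s `^ p = w by rewrite -powRrM mulVf ?gt_eqF// powRr1.
have powp_le (a b : R) : 0 <= a -> 0 <= b -> (a `^ p <= b `^ p) = (a <= b).
  by move=> a0 b0; rewrite powR_le_inv ?powR_ge0// -powRrM mulfV ?gt_eqF// powRr1.
have bE (x y : R) : 0 < x -> 0 <= y -> y `^ p <= 1 -> pball p (x, y) <-> x <= arc p y.
  move=> x0 y0 y1; rewrite /pball/= !ger0_norm ?(ltW x0)// -lerBrDr.
  by rewrite powR_le_inv ?(ltW x0) ?subr_ge0// /arc (ger0_norm y0) ger0_norm ?subr_ge0.
rewrite area_ysection; last exact: measurable_wedge.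
have secE y : y \in `[0, s] -> mu (ysection (wedge c s) y) = (arc p y - c / s * y)%:E
    \/ s = 0.
  rewrite in_itv/= => /andP[y0 ys]; have [->|sN0] := eqVneq s 0; [by right|left].
  have {sN0} s0' : 0 < s by rewrite lt_neqAle eq_sym sN0.
  have yw : y `^ p <= w by rewrite -sp powp_le.
  have yp : y `^ p <= 1 by exact: le_trans w1.
  pose d := c / s * y; have d0 : 0 <= d by rewrite !mulr_ge0// invr_ge0.
  (* The point (c, s) lies on the arc and [y <= s], so the line, the abscissa [c] and the arc are
     ordered as d <= c <= arc y. *)
  have cb : c <= arc p y.
    rewrite /arc (ger0_norm y0) ger0_norm ?subr_ge0// -powR_le_inv ?subr_ge0//.
    by rewrite cp lerD2l lerN2.
  have db : d <= arc p y.
    by apply: le_trans cb; rewrite /d mulrAC ler_pdivrMr// ler_wpM2l.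
  (* The left end is closed for d > 0 and open for d = 0, where the strict condition on the first
     coordinate excludes it. *)
  have -> : ysection (wedge c s) y = [set` Interval (BSide (0 < d) d) (BRight (arc p y))].
    apply/seteqP; split => x; rewrite /ysection/= inE.
      move=> [/= x0 _ h /bE]; rewrite in_itv/= => -> //; rewrite andbT.
      have dx : d <= x by rewrite /d mulrAC ler_pdivrMr// mulrC.
      by rewrite /Order.lteif; case: ltP => // d0'; exact: le_lt_trans x0.
    rewrite in_itv/= => /andP[dx xb].
    have [x0 dx'] : 0 < x /\ d <= x.
      move: dx; rewrite /Order.lteif; case: ifPn => [d0' dx|_ dx].
        by split => //; exact: lt_le_trans dx.
      by split; [exact: le_lt_trans dx|exact: ltW].
    split => //=; last by apply/bE.
    by move: dx'; rewrite /d mulrAC ler_pdivrMr// mulrC.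
  rewrite lebesgue_measure_itv/=.
  case: ifPn => [_|]; first by rewrite -EFinB.
  rewrite -leNgt => h.
  have -> : arc p y = d; last by rewrite subrr.
  apply/eqP; rewrite eq_le db andbT; move: h.
  by case: (0 < d); rewrite ?bnd_simp// ?lee_fin.
have secN y : y \notin `[0, s] -> mu (ysection (wedge c s) y) = 0%E.
  move=> yN; rewrite (_ : ysection _ _ = set0) ?measure0//.
  apply/seteqP; split => x //; rewrite /ysection/= inE => -[/= x0 y0 h].
  rewrite /pball/= !ger0_norm ?(ltW x0)// => xy.
  move: yN; rewrite in_itv/= y0/= -ltNge => sy.
  have wy : w < y `^ p by rewrite -sp gt0_ltr_powR ?nnegrE.
  have xc : x < c.
    rewrite ltNge -powp_le ?(ltW x0)// cp -ltNge.
    apply: (@le_lt_trans _ _ (1 - y `^ p)); first by rewrite lerBrDr.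
    by rewrite ltrD2l ltrN2.
  have : y * c < y * c; last by rewrite ltxx.
  apply: le_lt_trans h _; apply: (@lt_le_trans _ _ (x * y)).
    by rewrite ltr_pM2l.
  by rewrite mulrC ler_wpM2l// ltW.
transitivity (\int[mu]_(y in `[0%R, s]) mu (ysection (wedge c s) y))%E.
  rewrite [RHS]integral_mkcond; apply: eq_integral => y _.
  by rewrite patchE mem_setE; case: ifPn => // /secN.
have [s00|sN0] := eqVneq s 0.
  rewrite s00 set_itv1 integral_set1.
  have -> : w = 0 by rewrite -sp s00 powR0 ?gt_eqF.
  by rewrite sarea0.
have s0' : 0 < s by rewrite lt_neqAle eq_sym sN0.
under eq_integral => y ys.
  rewrite (_ : mu _ = (arc p y - c / s * y)%:E); last first.
    by move: ys; rewrite mem_setE => /secE[//|/eqP]; rewrite (negbTE sN0).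
  over.
pose F (y : R) := arc_primitive p `|y| - c / s / 2 * (y * y).
have cF : continuous F.
  move=> y; apply: cvgB.
    apply: (@cvg_comp_at _ (arc_primitive p) (fun t : R => `|t|)).
      exact: norm_continuous.
    by apply: continuous_arc_primitive => //; rewrite (lt_le_trans (ltrN10 _)).
  by apply: cvgMr; apply: cvgM; exact: cvg_id.
rewrite (ge0_FTC2 s0' (F := F))//.
- rewrite /F normr0 arc_primitive0 !mulr0 subr0 subr0 (gtr0_norm s0') /sarea.
  rewrite (ger0_norm w0) ger0_norm ?mulr_ge0// powRM// -/c -/s.
  by congr EFin; field; rewrite gt_eqF.
- move=> y ys; have ys' : y \in `[0, s] by exact: subset_itv_oo_cc ys.
  have [h|/eqP] := secE y ys'; last by rewrite (negbTE sN0).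
  by rewrite -lee_fin -h measure_ge0.
- move=> y _; apply: cvgB; first exact: continuous_arc.
  by apply: cvgMr; exact: cvg_id.
- move=> y; rewrite in_itv/= => /andP[y0 _].
  have y1 : -1 < y by rewrite (lt_trans (ltrN10 _)).
  have d1 := is_derive_arc_primitive p0 y1.
  have d2 := is_deriveZ (c / s / 2) (is_deriveM (is_derive_id y (1 : R)) (is_derive_id y (1 : R))).
  have d3 := is_deriveB d1 d2.
  apply: near_eq_is_derive; last first.
    by apply: (is_derive_eq d3); rewrite /GRing.scale/=; field; rewrite gt_eqF.
  by near=> t; rewrite /F ger0_norm// ltW//; near: t; exact: lt_nbhsr.
Unshelve. all: by end_near. Qed.

Lemma pball_rotN (z : R * R) : pball p (rotN z) <-> pball p z.
Proof. by rewrite /pball /rotN/= normrN addrC. Qed.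

Lemma area_quadrant : area (wedge 0 1) = (sarea p 1)%:E.
Proof.
by rewrite -area_wedge ?ler01 ?lexx// subrr powR0 ?powR1 ?gt_eqF.
Qed.

(** The half-open quadrant [H] owns the positive x-axis but not the positive y-axis, so its four
    turned copies partition the ball without the origin. Nesting the turns lets one [step] add one
    quadrant at a time. *)
Lemma area_pball : area (pball p) = (Sp p)%:E.
Proof.
pose rot (S : set (R * R)) := @rotN R @^-1` S.
pose H := wedge 0 1.
have mH : measurable H by exact: measurable_wedge.
have mr S : measurable S -> measurable (rot S) by exact: measurable_preimage_rotN.
have HE z : H z <-> [/\ 0 < z.1, 0 <= z.2 & pball p z].
  split => [[? ? ? ?]//|[z1 z2 zp]]; split => //.
  by rewrite mulr0 mulr1 ltW.
have step S : measurable S -> H `&` rot S = set0 ->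
    area (H `|` rot S) = ((sarea p 1)%:E + area S)%E.
  move=> mS HS; rewrite areaU//; last exact: mr.
  by rewrite area_rotN// area_quadrant.
pose A1 := H `|` rot H; pose A2 := H `|` rot A1; pose A3 := H `|` rot A2.
have mA1 : measurable A1 by apply: measurableU => //; exact: mr.
have mA2 : measurable A2 by apply: measurableU => //; exact: mr.
have mA3 : measurable A3 by apply: measurableU => //; exact: mr.
have [d1 d2 d3] : [/\ H `&` rot H = set0, H `&` rot A1 = set0 & H `&` rot A2 = set0].
  split; apply/seteqP; split => z //.
  - by move=> [/HE[? ? ?] /HE[/= ? ? ?]]; lra.
  - by move=> [/HE[? ? ?] [|] /HE[/= ? ? ?]]; lra.
  - by move=> [/HE[? ? ?] [|[|]] /HE[/= ? ? ?]]; lra.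
have HP z : H z -> pball p z by move=> /HE[].
have UP (S : set (R * R)) :
    (forall z, S z -> pball p z) -> forall z, (H `|` rot S) z -> pball p z.
  by move=> SP z [/HP//|/SP/pball_rotN].
have H3 : forall z, A3 z -> pball p z := UP _ (UP _ (UP _ HP)).
have -> : pball p = [set (0, 0)] `|` A3.
  apply/seteqP; split => [z zp|z].
    have Hz x y : 0 < x -> 0 <= y -> pball p (x, y) -> H (x, y) by move=> *; apply/HE.
    have r1 := (pball_rotN z).2 zp; have r2 := (pball_rotN _).2 r1.
    have r3 := (pball_rotN _).2 r2; clear d1 d2 d3.
    case: z zp r1 r2 r3 => x y zp r1 r2 r3; rewrite /rotN/= in r1 r2 r3.
    have [x0|x0|x0] := ltgtP x 0; have [y0|y0|y0] := ltgtP y 0;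
      try (by left; rewrite x0 y0); right;
      do ?[by left; apply: Hz => //=; lra | by apply: Hz => //=; lra | right].
  move=> [->|].
    by rewrite /pball/= normr0 powR0 ?gt_eqF// addr0.
  exact: H3.
rewrite areaU//; [|exact: measurable_set1_pair|]; last first.
  apply/seteqP; split => z // -[-> /=].
  by move=> [/HE[]|[/HE[]|[/HE[]|/HE[]]]] /=; rewrite ?oppr0 ltxx.
rewrite area_set1 add0e !step// area_quadrant -!EFinD (Sp_sarea p0); congr EFin; ring.
Qed.

End BallArea.

(** * Areas of sectors of arbitrary polar angle *)

Section SectorArea.
Variables (R : realType) (p : R).
Hypothesis p0 : 0 < p.
Implicit Types (alpha r t x y : R) (z : R * R).

Lemma polar_quarter x y : 0 < x -> 0 <= y ->
  exists r t, [/\ 0 < r, 0 <= t < pi / 2, x = r * cos t & y = r * sin t].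
Proof.
move=> x0 y0; pose t := atan (y / x).
have t1 : t < pi / 2 := atan_ltpi2 _.
have t0 : 0 <= t by rewrite -(@atan0 R) le_atan// divr_ge0// ltW.
have ct : 0 < cos t.
  by apply: cos_gt0_pihalf; rewrite t1 andbT (lt_le_trans _ t0)// oppr_lt0 divr_gt0// pi_gt0.
exists (x / cos t), t; split; first exact: divr_gt0.
- by rewrite t0.
- by rewrite divfK// gt_eqF.
- rewrite mulrAC -mulrA -/(tan t) atanK; field; rewrite gt_eqF//.
Qed.

(* The sector without the origin, so that the quadrants partition it. *)
Definition psector alpha : set (R * R) :=
  [set z | pball p z /\ exists r t, [/\ 0 < r, 0 <= t <= alpha,
    z.1 = r * cos t & z.2 = r * sin t]].

Lemma sector_psector alpha : 0 <= alpha ->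
  sector (pball p) alpha = [set (0, 0)] `|` psector alpha.
Proof.
move=> a0; apply/seteqP; split => z.
  move=> [zp [r [t [r0 [tr zE]]]]]; move: r0; rewrite le_eqVlt => /predU1P[r0|r0].
    by left; rewrite zE -r0 !mul0r.
  by right; split => //; exists r, t; rewrite zE.
move=> [->|[zp [r [t [r0 tr z1 z2]]]]].
  split; first by rewrite /pball/= normr0 powR0 ?gt_eqF// addr0.
  by exists 0, 0; rewrite !mul0r !lexx.
by split => //; exists r, t; rewrite ltW// -z1 -z2; case: (z).
Qed.

(** In polar coordinates the wedge inequality reads sin(alpha - t) >= 0, which within a quarter turn
    means t <= alpha. *)
Lemma psector_quarter alpha : 0 <= alpha < pi / 2 ->
  psector alpha = wedge p (cos alpha) (sin alpha).
Proof.
move=> /andP[a0 a1]; have pi0 := pi_gt0 R; apply/seteqP; split => z.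
  move=> [zp [r [t [r0 /andP[t0 ta] z1 z2]]]]; split => //.
  - by rewrite z1 mulr_gt0// cos_gt0_pihalf//; apply/andP; split; lra.
  - by rewrite z2 mulr_ge0 ?(ltW r0)// sin_ge0_pi//; apply/andP; split; lra.
  - rewrite z1 z2 -!mulrA ler_pM2l// -subr_ge0 [_ * sin alpha]mulrC.
    rewrite [sin t * _]mulrC -sinB.
    by apply: sin_ge0_pi; apply/andP; split; lra.
move=> [z1 z2 h zp]; split => //.
have [r [t [r0 /andP[t0 t1] e1 e2]]] := polar_quarter z1 z2.
exists r, t; split => //; rewrite t0/= leNgt; apply/negP => at_.
move: h; rewrite e1 e2 -!mulrA ler_pM2l// => h.
have : 0 < sin (t - alpha) by apply: sin_gt0_pi; apply/andP; split; lra.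
rewrite sinB; lra.
Qed.

Lemma psector_shift alpha : 0 <= alpha ->
  psector (alpha + pi / 2) = wedge p 0 1 `|` @rotN R @^-1` psector alpha.
Proof.
move=> a0; have pi0 := pi_gt0 R; apply/seteqP; split => z.
  move=> [zp [r [t [r0 /andP[t0 ta] z1 z2]]]].
  have [tp|tp] := ltP t (pi / 2).
    left; have c0 : 0 < z.1.
      by rewrite z1 mulr_gt0// cos_gt0_pihalf//; apply/andP; split; lra.
    split => //; last by rewrite mulr0 mulr1 ltW.
    by rewrite z2 mulr_ge0 ?(ltW r0)// sin_ge0_pi//; apply/andP; split; lra.
  right; split; first exact/pball_rotN.
  exists r, (t - pi / 2); split => //=.
  - by apply/andP; split; lra.
  - by rewrite cosBpihalf.
  - by rewrite sinBpihalf z1 mulrN.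
move=> [[z1 z2 _ zp]|[/pball_rotN zp [r [t [r0 /andP[t0 ta] /= z1 z2]]]]]; split => //.
  have [r [t [r0 /andP[t0 t1] e1 e2]]] := polar_quarter z1 z2.
  by exists r, t; split => //; apply/andP; split; lra.
exists r, (t + pi / 2); split => //.
- by apply/andP; split; lra.
- by rewrite cosDpihalf mulrN -z2 opprK.
- by rewrite sinDpihalf.
Qed.

(** A common point would force cos t >= 0 and sin t < 0, that is, t in the fourth quadrant, whereas
    t <= alpha < 3 pi/2. *)
Lemma psector_shift_disj alpha : 0 <= alpha -> alpha + pi / 2 < 2 * pi ->
  wedge p 0 1 `&` @rotN R @^-1` psector alpha = set0.
Proof.
move=> a0 a1; have pi0 := pi_gt0 R; apply/seteqP; split => z //.
move=> [[z1 z2 _ zp] [_ [r [t [r0 /andP[t0 ta] /= e1 e2]]]]].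
have c0 : 0 <= cos t by rewrite -(pmulr_rge0 _ r0) -e1.
have s0 : sin t < 0 by rewrite -(pmulr_rlt0 _ r0) -e2 oppr_lt0.
have [tp|tp] := leP t pi.
  by have : 0 <= sin t; [apply: sin_ge0_pi; rewrite t0|lra].
have : 0 < cos (t - pi) by apply: cos_gt0_pihalf; apply/andP; split; lra.
rewrite cosB cospi sinpi; lra.
Qed.

(** [beta] is the polar angle and [r] the inverse-free scale of the point with parameter [w]: the
    ray at [beta] passes through ((1-w)^(1/p), w^(1/p)) at distance [r]. Measurability joins the
    induction because additivity of area requires it. *)
Lemma measurable_area_psector (n : nat) (beta w r : R) :
  0 <= beta < pi / 2 -> beta + n%:R * (pi / 2) < 2 * pi -> 0 <= w <= 1 -> 0 < r ->
  (1 - w) `^ p^-1 = r * cos beta -> w `^ p^-1 = r * sin beta ->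
  measurable (psector (beta + n%:R * (pi / 2))) /\
  area (psector (beta + n%:R * (pi / 2))) = (n%:R * sarea p 1 + sarea p w)%:E.
Proof.
move=> b01 + w01 r0 ec es; have pi0 := pi_gt0 R.
elim: n => [|n IH] hn.
  rewrite !mul0r addr0 add0r psector_quarter// -(wedgeZ p _ _ r0) -ec -es.
  by split; [exact: measurable_wedge|exact: area_wedge].
have n0 : 0 <= beta + n%:R * (pi / 2).
  by case/andP: b01 => b0 _; rewrite addr_ge0// mulr_ge0// divr_ge0// ltW.
have e : beta + n.+1%:R * (pi / 2) = beta + n%:R * (pi / 2) + pi / 2.
  by rewrite -natr1; ring.
rewrite e in hn *; have [|mS aS] := IH; first by lra.
rewrite psector_shift//; split.
  by apply: measurableU; [exact: measurable_wedge|exact: measurable_preimage_rotN].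
rewrite areaU ?psector_shift_disj//; [|exact: measurable_wedge|exact: measurable_preimage_rotN].
by rewrite area_rotN// area_quadrant// aS -EFinD -natr1; congr EFin; ring.
Qed.

Lemma area_sector (n : nat) (beta w r : R) :
  0 <= beta < pi / 2 -> beta + n%:R * (pi / 2) < 2 * pi -> 0 <= w <= 1 -> 0 < r ->
  (1 - w) `^ p^-1 = r * cos beta -> w `^ p^-1 = r * sin beta ->
  area (sector (pball p) (beta + n%:R * (pi / 2))) = (n%:R * sarea p 1 + sarea p w)%:E.
Proof.
move=> b01 hn w01 r0 ec es; have pi0 := pi_gt0 R.
have [mS aS] := measurable_area_psector b01 hn w01 r0 ec es.
rewrite sector_psector.
  rewrite areaU//; [by rewrite area_set1 add0e|exact: measurable_set1_pair|].
  apply/seteqP; split => z // -[-> [_ [s [t [s0 _ /= e1 e2]]]]].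
  have /eqP := cos2Dsin2 t; have sN0 : s != 0 by rewrite gt_eqF.
  move/esym/eqP: e1; rewrite mulf_eq0 (negbTE sN0)/= => /eqP ->.
  move/esym/eqP: e2; rewrite mulf_eq0 (negbTE sN0)/= => /eqP ->.
  by rewrite expr0n addr0 eq_sym oner_eq0.
by case/andP: b01 => b0 _; rewrite addr_ge0// mulr_ge0// divr_ge0// ltW.
Qed.

End SectorArea.

(** * Shifts by integer multiples of a period *)

Section PeriodicInt.
Variable R : realType.

Lemma periodic_int (f : R -> R) (T x : R) (k : int) :
  (forall y, f (y + T) = f y) -> f (x + k%:~R * T) = f x.
Proof.
move=> fT; have P (m : nat) y : f (y + m%:R * T) = f y.
  elim: m => [|m IH]; first by rewrite mul0r addr0.
  by rewrite -natr1 mulrDl mul1r addrA fT.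
case: k => [m|m]; first exact: P.
rewrite -(P m.+1); congr f; rewrite NegzE mulrNz mulNr subrK//.
Qed.

Lemma sqr_sin_shift (x : R) (k : int) : sin (x + k%:~R * pi) ^+ 2 = sin x ^+ 2.
Proof.
by apply: (@periodic_int (fun y => sin y ^+ 2)) => y; rewrite sinDpi sqrrN.
Qed.

End PeriodicInt.

(** * [Theta] on each quarter turn, and its bijectivity *)

Section ThetaBijection.
Variables (R : realType) (p : R).
Hypothesis p0 : 0 < p.
Implicit Types (psi phi theta : R) (n k : int).

Let pi0 : 0 < pi :> R. Proof. exact: pi_gt0. Qed.
Let Q0 : 0 < sarea p 1. Proof. exact: sarea1_gt0. Qed.

(** The square root in [incB_sarea] becomes |cos 2psi|, so the argument on the right is the smaller
    of sin^2 psi and cos^2 psi. *)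
Lemma incB_sin (psi : R) :
  p^-1 * 4 `^ (- p^-1) * incB (sin (2 * psi) ^+ 2) p^-1 2^-1 =
  2 * sarea p ((1 - `|cos (2 * psi)|) / 2).
Proof.
have h : 0 <= sin (2 * psi) ^+ 2 <= 1.
  by rewrite sqr_ge0 sin2cos2 lerBlDr lerDl sqr_ge0.
rewrite incB_sarea// -cos2sin2 ger0_norm ?sqr_ge0//.
rewrite powR12_sqrt ?sqr_ge0// sqrtr_sqr powRN.
have k0 : (4 : R) `^ p^-1 != 0 by rewrite gt_eqF// powR_gt0.
by field; rewrite k0 gt_eqF.
Qed.

(** [j] tells in which half of the quarter turn [psi] lies, so k = 2n + j and k - floor(k/2) = n +
    j. For j = 1 the formula counts n + 1 full quadrants and subtracts the area for cos^2 psi, which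
    [sarea_onem] turns into n quadrants plus the area for sin^2 psi. *)
Lemma Theta_quarter n psi : 0 <= psi < pi / 2 ->
  Theta p (psi + n%:~R * (pi / 2)) = 2 * (n%:~R * sarea p 1 + sarea p (sin psi ^+ 2)).
Proof.
move=> /andP[s0 s1]; pose j : int := (pi / 4 <= psi)%R.
have piN0 : pi != 0 :> R by rewrite gt_eqF.
have jE : (pi / 4 <= psi /\ j%:~R = 1 :> R) \/ (psi < pi / 4 /\ j%:~R = 0 :> R).
  by rewrite /j; case: leP => h; [left|right].
have /andP[j0 j1] : (j%:~R : R) <= 4 * psi / pi < j%:~R + 1.
  rewrite ler_pdivlMr// ltr_pdivrMr//.
  by case: jE => -[h ->]; apply/andP; split; lra.
have kE : Num.floor (4 * (psi + n%:~R * (pi / 2)) / pi) = 2 * n + j.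
  apply: floor_def.
  have fE (x y z : R) : z != 0 -> 4 * (x + y * (z / 2)) / z = 4 * x / z + 2 * y.
    by move=> ?; field.
  rewrite fE//.
  by rewrite !intrD intrM -[2%:~R]/(2 : R) -[1%:~R]/(1 : R); apply/andP; split; lra.
have kE2 : Num.floor ((2 * n + j)%:~R / 2 : R) = n.
  apply: floor_def; rewrite !intrD intrM -[2%:~R]/(2 : R).
  rewrite ler_pdivlMr// ltr_pdivrMr// -[1%:~R]/(1 : R).
  by case: jE => -[h ->]; apply/andP; split; lra.
have sE : (-1 : R) ^ (2 * n + j) = (-1) ^ j.
  rewrite expfzDr ?oppr_eq0 ?oner_eq0// -exprz_exp.
  by rewrite (_ : (-1 : R) ^ 2 = 1) ?exp1rz ?mul1r// -exprnP expr2 mulrNN mulr1.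
rewrite /Theta kE kE2 sE Sp_sarea//.
have -> : sin (2 * (psi + n%:~R * (pi / 2))) ^+ 2 = sin (2 * psi) ^+ 2.
  by rewrite -[RHS](sqr_sin_shift _ n); congr (sin _ ^+ 2); field.
rewrite incB_sin !intrD intrM -[2%:~R]/(2 : R).
have c2 : cos (2 * psi) = 1 - 2 * sin psi ^+ 2.
  rewrite mulrC mulr_natr cos_mulr2n cos2sin2; ring.
have cs : cos psi ^+ 2 = 1 - sin psi ^+ 2 := cos2sin2 _.
have [h|h] := leP (pi / 4) psi.
  have e : j = 1 by rewrite /j h.
  have c0 : cos (2 * psi) <= 0.
    have -> : cos (2 * psi) = - cos (2 * psi - pi) by rewrite -cosDpi subrK.
    by rewrite oppr_le0; apply: cos_ge0_pihalf; apply/andP; split; lra.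
  rewrite e ler0_norm// c2.
  have := sarea_onem p0 (_ : 0 <= sin psi ^+ 2 <= 1).
  rewrite sqr_ge0 -[X in _ <= X](cos2Dsin2 psi) lerDr sqr_ge0 => /(_ isT) <-.
  rewrite (_ : (1 - - (1 - 2 * sin psi ^+ 2)) / 2 = 1 - sin psi ^+ 2); last by field.
  by rewrite expr1z; field.
have e : j = 0 by rewrite /j leNgt h.
have c0 : 0 <= cos (2 * psi) by apply: cos_ge0_pihalf; apply/andP; split; lra.
rewrite e ger0_norm// c2 (_ : (1 - (1 - 2 * sin psi ^+ 2)) / 2 = sin psi ^+ 2); last by field.
by rewrite expr0z; field.
Qed.

Lemma angle_quarter phi : exists n psi, 0 <= psi < pi / 2 /\ phi = psi + n%:~R * (pi / 2).
Proof.
have h0 : 0 < pi / 2 :> R by rewrite divr_gt0.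
pose n := Num.floor (phi / (pi / 2)); exists n, (phi - n%:~R * (pi / 2)).
split; last by rewrite subrK.
have /andP[h1 h2] := floor_itv (phi / (pi / 2)).
rewrite ler_pdivlMr// in h1; rewrite ltr_pdivrMr// intrD mulrDl mul1r in h2.
by apply/andP; split; rewrite -/n in h1 h2 *; lra.
Qed.

Lemma sin_quarter psi : 0 <= psi < pi / 2 -> 0 <= sin psi < 1.
Proof.
move=> /andP[s0 s1]; apply/andP; split.
  by apply: sin_ge0_pi; rewrite s0 ltW// (lt_trans s1)//; lra.
by rewrite -(@sin_pihalf R) ltr_sin ?in_itv/=//; apply/andP; split; lra.
Qed.

Lemma sarea_sin_itv psi : 0 <= psi < pi / 2 -> 0 <= sarea p (sin psi ^+ 2) < sarea p 1.
Proof.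
move=> /sin_quarter/andP[s0 s1].
have s21 : sin psi ^+ 2 < 1 by rewrite expr_lt1.
apply/andP; split; last by apply: sarea_lt => //; rewrite sqr_ge0.
have := sqr_ge0 (sin psi); rewrite le_eqVlt => /predU1P[<-|s2].
  by rewrite sarea0.
by rewrite -(sarea0 p0) ltW// sarea_lt// ltW.
Qed.

Lemma quarter_uniq (n m : int) (x y q : R) : 0 <= x < q -> 0 <= y < q ->
  n%:~R * q + x = m%:~R * q + y -> n = m /\ x = y.
Proof.
move=> /andP[x0 xq] /andP[y0 yq] e; have q0 : 0 < q := le_lt_trans x0 xq.
have hx : Num.floor ((n%:~R * q + x) / q) = n.
  apply: floor_def; rewrite ler_pdivlMr// ltr_pdivrMr// intrD mulrDl mul1r.
  by apply/andP; split; lra.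
have hy : Num.floor ((m%:~R * q + y) / q) = m.
  apply: floor_def; rewrite ler_pdivlMr// ltr_pdivrMr// intrD mulrDl mul1r.
  by apply/andP; split; lra.
have nm : n = m by rewrite -hx e hy.
by split => //; move: e; rewrite nm => /addrI.
Qed.

(** Division with remainder by [sarea p 1] separates the quadrant from the position inside it; there
    [sarea] and the sine are injective. *)
Lemma Theta_inj : injective (Theta p).
Proof.
move=> a b; have [n [x [xq ->]]] := angle_quarter a; have [m [y [yq ->]]] := angle_quarter b.
have two0 : 2 != 0 :> R by rewrite pnatr_eq0.
rewrite !Theta_quarter// => /(mulfI two0).
move=> /(quarter_uniq (sarea_sin_itv xq) (sarea_sin_itv yq))[-> e].
have /andP[sx0 sx1] := sin_quarter xq; have /andP[sy0 sy1] := sin_quarter yq.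
have s2 : sin x ^+ 2 = sin y ^+ 2.
  have lt1 z : 0 <= z -> z < 1 -> z ^+ 2 <= 1 :> R by move=> *; rewrite expr_le1// ltW.
  case: (ltgtP (sin x ^+ 2) (sin y ^+ 2)) => // h.
    by have := sarea_lt p0 (sqr_ge0 _) h (lt1 _ sy0 sy1); rewrite e ltxx.
  by have := sarea_lt p0 (sqr_ge0 _) h (lt1 _ sx0 sx1); rewrite e ltxx.
have : sin x = sin y by apply/eqP; rewrite -(eqrXn2 (n := 2))// s2.
move=> /sin_inj -> //; rewrite in_itv/=.
- by case/andP: xq => ? ?; apply/andP; split; lra.
- by case/andP: yq => ? ?; apply/andP; split; lra.
Qed.

Lemma Theta_surj theta : exists phi, Theta p phi = theta.
Proof.
have q0 : 0 < 2 * sarea p 1 by rewrite mulr_gt0.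
pose n := Num.floor (theta / (2 * sarea p 1)); pose r := theta / 2 - n%:~R * sarea p 1.
have /andP[h1 h2] := floor_itv (theta / (2 * sarea p 1)).
rewrite ler_pdivlMr// in h1; rewrite ltr_pdivrMr// intrD mulrDl mul1r in h2.
rewrite -/n in h1 h2.
have r0 : 0 <= r by rewrite /r; lra.
have r1 : r < sarea p 1 by rewrite /r; lra.
have [|||w] := @IVT R (sarea p) 0 1 r.
- exact: ler01.
- by apply: continuous_subspaceT => t; exact: continuous_sarea.
- by rewrite sarea0// ge_min r0/= le_max (ltW r1) orbT.
rewrite in_itv/= => /andP[w0 w1] wr.
(* Strictness keeps the angle asin(sqrt w) below pi/2, as [Theta_quarter] demands. *)
have w1' : w < 1.
  by rewrite lt_neqAle w1 andbT; apply/eqP => e; move: r1; rewrite -wr e ltxx.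
have s0 : 0 <= Num.sqrt w by exact: sqrtr_ge0.
have s1 : Num.sqrt w < 1 by rewrite -sqrtr1 ltr_sqrt.
have si : -1 <= Num.sqrt w < 1 by rewrite s1 (le_trans _ s0)// oppr_le0.
have si' : -1 <= Num.sqrt w <= 1 by rewrite (ltW s1) (le_trans _ s0)// oppr_le0.
have asK : sin (asin (Num.sqrt w)) = Num.sqrt w by rewrite asinK// in_itv.
exists (asin (Num.sqrt w) + n%:~R * (pi / 2)).
rewrite Theta_quarter.
  by rewrite asK sqr_sqrtr// wr /r; field.
rewrite asin_ltpi2// andbT leNgt; apply/negP => h.
have : 0 < sin (- asin (Num.sqrt w)).
  apply: sin_gt0_pi; rewrite oppr_gt0 h/= ltrNl.
  by have := asin_geNpi2 si'; have := pi_gt0 R; lra.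
by rewrite sinN asK oppr_gt0 ltNge s0.
Qed.

Lemma varphiK theta : Theta p (varphi p theta) = theta.
Proof.
exact: (@xgetPex _ 0 [set phi | Theta p phi = theta] (Theta_surj theta)).
Qed.

Lemma ThetaK phi : varphi p (Theta p phi) = phi.
Proof. by apply: Theta_inj; exact: varphiK. Qed.

Lemma Theta_shift phi k : Theta p (phi + k%:~R * (2 * pi)) = Theta p phi + k%:~R * (2 * Sp p).
Proof.
have [n [x [xq ->]]] := angle_quarter phi.
rewrite (_ : x + _ + _ = x + (n + 4 * k)%:~R * (pi / 2)); last first.
  by rewrite intrD intrM; field.
by rewrite !Theta_quarter// Sp_sarea// intrD intrM; ring.
Qed.

Lemma varphi_shift theta k :
  varphi p (theta + k%:~R * (2 * Sp p)) = varphi p theta + k%:~R * (2 * pi).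
Proof. by apply: Theta_inj; rewrite varphiK Theta_shift varphiK. Qed.

(** It puts the parameter of a reduced [theta] into a single turn, where a ray with polar angle in
    [0, 2 pi) can be found. *)
Lemma Theta_itv phi : 0 <= Theta p phi < 2 * Sp p -> 0 <= phi < 2 * pi.
Proof.
have [n [x [xq ->]]] := angle_quarter phi; rewrite Theta_quarter// Sp_sarea//.
have /andP[a0 a1] := sarea_sin_itv xq; case/andP: xq => x0 x1 /andP[h1 h2].
have n0 : 0 <= n.
  suff : -1 < n by lia.
  rewrite -(ltr_int R) ltNge; apply/negP => h.
  have : n%:~R * sarea p 1 <= (-1)%:~R * sarea p 1 by rewrite ler_pM2r.
  rewrite mulrNz mulr1z; lra.
have n4 : n <= 3.
  suff : n < 4 by lia.
  rewrite -(ltr_int R) ltNge; apply/negP => h.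
  have : 4%:~R * sarea p 1 <= n%:~R * sarea p 1 by rewrite ler_pM2r.
  rewrite -[4%:~R]/(4 : R); lra.
have n0' : 0 <= n%:~R * (pi / 2) :> R by rewrite mulr_ge0 ?ler0z// divr_ge0// ltW.
have n4' : n%:~R * (pi / 2) <= 3%:~R * (pi / 2) :> R by rewrite ler_pM2r ?divr_gt0// ler_int.
by rewrite -[3%:~R]/(3 : R) in n4'; apply/andP; split; lra.
Qed.

End ThetaBijection.

(** * Boundary points, their rays, and the convex trigonometric functions *)

Section BoundaryPoint.
Variables (R : realType) (p : R).
Hypothesis p0 : 0 < p.
Implicit Types (alpha beta psi phi theta x y r : R) (z : R * R).

Let pi0 : 0 < pi :> R. Proof. exact: pi_gt0. Qed.

Definition spow x : R := `|x| `^ (2 / p) * Num.sg x.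

(** This is the p-th power of the norm, hence homogeneous of degree p. *)
Definition pnorm z : R := `|z.1| `^ p + `|z.2| `^ p.

Definition bpoint phi : R * R := (spow (cos phi), spow (sin phi)).

Lemma spowN x : spow (- x) = - spow x.
Proof. by rewrite /spow normrN sgrN mulrN. Qed.

Lemma spow_ge0 x : 0 <= x -> spow x = x `^ (2 / p).
Proof.
rewrite le_eqVlt /spow => /predU1P[<-|x0]; last by rewrite gtr0_norm// gtr0_sg// mulr1.
by rewrite sgr0 mulr0 powR0// mulf_neq0// invr_neq0// gt_eqF.
Qed.

Lemma spow_ge0_sqr x : 0 <= x -> spow x = (x ^+ 2) `^ p^-1.
Proof. by move=> x0; rewrite spow_ge0// powRrM powR_mulrn. Qed.

Lemma norm_spow x : `|spow x| `^ p = x ^+ 2.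
Proof.
have H y : 0 <= y -> `|spow y| `^ p = y ^+ 2.
  move=> y0; rewrite spow_ge0_sqr// ger0_norm ?powR_ge0// -powRrM mulVf ?gt_eqF//.
  by rewrite powRr1// sqr_ge0.
have [|/ltW x0] := leP 0 x; first exact: H.
by rewrite -{1}[x]opprK spowN normrN H ?oppr_ge0// sqrrN.
Qed.

Lemma pnorm_bpoint phi : pnorm (bpoint phi) = 1.
Proof. by rewrite /pnorm /bpoint/= !norm_spow cos2Dsin2. Qed.

Lemma bpoint_shift phi (k : int) : bpoint (phi + k%:~R * (2 * pi)) = bpoint phi.
Proof.
rewrite /bpoint (@periodic_int _ (@cos R)); last first.
  by move=> y; rewrite mulrC mulr_natr cosD2pi.
by rewrite (@periodic_int _ (@sin R))// => y; rewrite mulrC mulr_natr sinD2pi.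
Qed.

(** A quarter turn acts on the parameter [psi] and on the polar angle [beta] in the same way,
    because [spow] is odd. *)
Lemma bpoint_ray (n : nat) psi beta r :
  spow (cos psi) = r * cos beta -> spow (sin psi) = r * sin beta ->
  bpoint (psi + n%:R * (pi / 2)) =
    (r * cos (beta + n%:R * (pi / 2)), r * sin (beta + n%:R * (pi / 2))).
Proof.
move=> ec es; elim: n => [|n]; first by rewrite mul0r !addr0 /bpoint ec es.
have e y : y + n.+1%:R * (pi / 2) = y + n%:R * (pi / 2) + pi / 2.
  by rewrite -(natr1 n); ring.
rewrite !e /bpoint => -[e1 e2].
by rewrite !cosDpihalf !sinDpihalf spowN e1 e2 mulrN.
Qed.

Lemma area_sector_Theta (n : nat) psi beta r :
  0 <= psi < pi / 2 -> 0 <= beta < pi / 2 -> 0 < r -> (n < 4)%N ->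
  spow (cos psi) = r * cos beta -> spow (sin psi) = r * sin beta ->
  area (sector (pball p) (beta + n%:R * (pi / 2))) =
    (Theta p (psi + n%:R * (pi / 2)) / 2)%:E.
Proof.
move=> hpsi hbeta r0 n4 ec es.
have n3 : n%:R <= 3 :> R by rewrite ler_nat.
have hn : n%:R * (pi / 2) <= 3 * (pi / 2) :> R by rewrite ler_pM2r// divr_gt0.
have /andP[s0 _] := sin_quarter hpsi.
have c0 : 0 <= cos psi.
  by apply: cos_ge0_pihalf; case/andP: hpsi => *; apply/andP; split; lra.
rewrite (area_sector p0 (w := sin psi ^+ 2) (r := r))//.
- rewrite -[n%:R * _]/((Posz n)%:~R * _) (Theta_quarter p0 (Posz n) hpsi).
  by congr EFin; field.
- by case/andP: hbeta => *; lra.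
- by rewrite sqr_ge0 sin2cos2 lerBlDr lerDl sqr_ge0.
- by rewrite -cos2sin2 -spow_ge0_sqr.
- by rewrite -spow_ge0_sqr.
Qed.

Lemma angle_quarter_nat phi : 0 <= phi < 2 * pi ->
  exists (n : nat) psi, [/\ (n < 4)%N, 0 <= psi < pi / 2 & phi = psi + n%:R * (pi / 2)].
Proof.
have h0 : 0 < pi / 2 :> R by rewrite divr_gt0.
have [n [x [/andP[x0 x1] ->]]] := angle_quarter phi => /andP[h1 h2].
have n0 : 0 <= n.
  suff : -1 < n by lia.
  rewrite -(ltr_int R) ltNge; apply/negP => h.
  have : n%:~R * (pi / 2) <= (-1)%:~R * (pi / 2) :> R by rewrite ler_pM2r.
  rewrite mulrNz mulr1z; lra.
have n4 : n < 4.
  rewrite -(ltr_int R) ltNge; apply/negP => h.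
  have : 4%:~R * (pi / 2) <= n%:~R * (pi / 2) :> R by rewrite ler_pM2r.
  rewrite -[4%:~R]/(4 : R); lra.
case: n n0 n4 h1 h2 => // n _ n4 h1 h2; exists n, x; split => //.
by rewrite x0.
Qed.

Lemma exists_ray_of_bpoint phi : 0 <= phi < 2 * pi -> exists alpha r,
  [/\ 0 <= alpha < 2 * pi, 0 < r, bpoint phi = (r * cos alpha, r * sin alpha) &
      area (sector (pball p) alpha) = (Theta p phi / 2)%:E].
Proof.
move=> /angle_quarter_nat[n [psi [n4 hpsi ->]]].
have n3 : n%:R <= 3 :> R by rewrite ler_nat.
have hn : n%:R * (pi / 2) <= 3 * (pi / 2) :> R by rewrite ler_pM2r// divr_gt0.
have hn0 : 0 <= n%:R * (pi / 2) :> R by rewrite mulr_ge0// divr_ge0// ltW.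
have c0 : 0 < cos psi.
  by apply: cos_gt0_pihalf; case/andP: hpsi => *; apply/andP; split; lra.
have /andP[s0 _] := sin_quarter hpsi.
have x0 : 0 < spow (cos psi) by rewrite spow_ge0 ?(ltW c0)// powR_gt0.
have y0 : 0 <= spow (sin psi) by rewrite spow_ge0// powR_ge0.
have [r [beta [r0 hb ec es]]] := polar_quarter x0 y0.
exists (beta + n%:R * (pi / 2)), r; split => //.
- by case/andP: hb => *; apply/andP; split; lra.
- exact: bpoint_ray.
- exact: area_sector_Theta hpsi hb r0 n4 ec es.
Qed.

(** It serves uniqueness: [is_Ptheta] supplies an arbitrary polar angle, and its sector area must be
    read as a value of [Theta]. *)
Lemma exists_bpoint_of_ray alpha : 0 <= alpha < 2 * pi -> exists phi r,
  [/\ 0 < r, bpoint phi = (r * cos alpha, r * sin alpha) &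
      area (sector (pball p) alpha) = (Theta p phi / 2)%:E].
Proof.
move=> /angle_quarter_nat[n [beta [n4 hb ->]]].
have c0 : 0 < cos beta.
  by apply: cos_gt0_pihalf; case/andP: hb => *; apply/andP; split; lra.
have /andP[s0 _] := sin_quarter hb.
(* The power 2/p is undone on the direction (cos beta, sin beta) by the power p/2; normalising the
   result to the unit circle yields [psi], and the factor [r] reappears as the radius r^(-2/p). *)
have [r [psi [r0 hpsi ec es]]] :=
  polar_quarter (powR_gt0 (p / 2) c0) (powR_ge0 (sin beta) (p / 2)).
have cp : 0 <= cos psi by rewrite -(pmulr_rge0 _ r0) -ec powR_ge0.
have sp : 0 <= sin psi by rewrite -(pmulr_rge0 _ r0) -es powR_ge0.
have K x t : 0 <= x -> 0 <= t -> x `^ (p / 2) = r * t ->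
    spow t = r^-1 `^ (2 / p) * x.
  move=> x0 t0 e; have -> : t = r^-1 * x `^ (p / 2) by rewrite e mulKf// gt_eqF.
  rewrite spow_ge0 ?mulr_ge0 ?powR_ge0 ?invr_ge0 ?(ltW r0)//.
  rewrite powRM ?powR_ge0 ?invr_ge0 ?(ltW r0)// -powRrM.
  rewrite (_ : p / 2 * (2 / p) = 1) ?powRr1//.
  by field; rewrite gt_eqF.
exists (psi + n%:R * (pi / 2)), (r^-1 `^ (2 / p)).
have r'0 : 0 < r^-1 `^ (2 / p) by rewrite powR_gt0// invr_gt0.
have e1 := K _ _ (ltW c0) cp ec; have e2 := K _ _ s0 sp es.
by split => //; [exact: bpoint_ray|exact: area_sector_Theta hpsi hb r'0 n4 e1 e2].
Qed.

Lemma pnormZ r z : 0 <= r -> pnorm (r * z.1, r * z.2) = r `^ p * pnorm z.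
Proof. by move=> r0; rewrite /pnorm/= !normrM (ger0_norm r0) !powRM// mulrDr. Qed.

Lemma continuous_pnorm : continuous pnorm.
Proof.
move=> z; apply: cvgD.
  apply: (@cvg_comp _ _ _ fst (fun t : R => `|t| `^ p) _ (nbhs z.1)); first exact: cvg_fst.
  exact: continuous_normr_powR.
apply: (@cvg_comp _ _ _ snd (fun t : R => `|t| `^ p) _ (nbhs z.2)); first exact: cvg_snd.
exact: continuous_normr_powR.
Qed.

(** Points with [pnorm] below 1 are interior by continuity; a point with [pnorm] equal to 1 is not,
    since stretching it by any factor above 1 leaves the ball. *)
Lemma bdry_pball z : bdry (pball p) z <-> pnorm z = 1.
Proof.
have cl : closed (pball p).
  rewrite (_ : pball p = pnorm @^-1` [set x | x <= 1])//.
  by apply: closed_comp; [move=> ? _; exact: continuous_pnorm|exact: closed_le].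
rewrite /bdry -(closure_id _).1//; split.
  move=> [zp zi]; apply/eqP; rewrite eq_le; apply/andP; split; first exact: zp.
  rewrite leNgt; apply/negP => z1; apply: zi.
  have op : open (pnorm @^-1` [set x | x < 1]).
    by apply: open_comp; [move=> ? _; exact: continuous_pnorm|exact: open_lt].
  apply: (@filterS _ (nbhs z) _ (pnorm @^-1` [set x | x < 1])); last exact: open_nbhs_nbhs.
  by move=> w /ltW.
move=> z1; split; first by rewrite /pball/= -/(pnorm z) z1.
move=> zi.
have cv : (fun t : R => (t * z.1, t * z.2)) t @[t --> (1 : R)] --> (1 * z.1, 1 * z.2).
  have h1 : (fun t : R => t * z.1) t @[t --> (1 : R)] --> (1 * z.1 : R).
    by apply: cvgMl; exact: cvg_id.
  have h2 : (fun t : R => t * z.2) t @[t --> (1 : R)] --> (1 * z.2 : R).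
    by apply: cvgMl; exact: cvg_id.
  exact: (cvg_pair h1 h2).
rewrite !mul1r -surjective_pairing in cv.
have /nbhs_ballP[e /= e0 he] := cv _ zi.
have /he : ball (1 : R) e (1 + e / 2).
  by rewrite /ball/= opprD addrA subrr sub0r normrN gtr0_norm ?divr_gt0//; lra.
rewrite /= /pball/= -/(pnorm (_, _)) pnormZ ?z1 ?mulr1; last by lra.
have : 1 `^ p < (1 + e / 2) `^ p.
  by apply: gt0_ltr_powR; rewrite ?nnegrE//; lra.
by rewrite powR1 ltNge => /negP.
Qed.

Lemma Sp_gt0 : 0 < Sp p.
Proof. by rewrite Sp_sarea// mulr_gt0// sarea1_gt0. Qed.

Lemma reduceE theta : reduce (Sp p) theta =
  theta + (- Num.floor (theta / (2 * Sp p)))%:~R * (2 * Sp p).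
Proof. by rewrite /reduce mulrNz mulNr [_%:~R * _]mulrC. Qed.

Lemma reduce_itv theta : 0 <= reduce (Sp p) theta < 2 * Sp p.
Proof.
have S0 : 0 < 2 * Sp p by rewrite mulr_gt0// Sp_gt0.
rewrite reduceE mulrNz mulNr.
have /andP[h1 h2] := floor_itv (theta / (2 * Sp p)).
rewrite ler_pdivlMr// in h1; rewrite ltr_pdivrMr// intrD mulrDl mul1r in h2.
by apply/andP; split; lra.
Qed.

Lemma bpoint_reduce theta :
  bpoint (varphi p (reduce (Sp p) theta)) = bpoint (varphi p theta).
Proof. by rewrite reduceE varphi_shift// bpoint_shift. Qed.

(** The area determines [Theta] of the parameter, hence the parameter itself by injectivity;
    homogeneity of [pnorm] then shows that a ray meets the boundary only once. *)
Lemma is_PthetaP theta z :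
  is_Ptheta (pball p) theta z <-> z = bpoint (varphi p theta).
Proof.
rewrite -bpoint_reduce /is_Ptheta area_pball//=.
set th := reduce _ _; split.
  move=> [/bdry_pball z1 [alpha [r [ha [r0 [zE aE]]]]]].
  have [phi [r' [r'0 bE]]] := exists_bpoint_of_ray ha.
  rewrite aE => -[] /(divIf _)-/(_ _) => e.
  have th_phi : th = Theta p phi by apply: e; rewrite pnatr_eq0.
  rewrite th_phi ThetaK// bE zE.
  have n1 := pnorm_bpoint phi; rewrite bE -[r' * cos _]/(r' * (cos alpha, sin alpha).1) in n1.
  rewrite -[r' * sin _]/(r' * (cos alpha, sin alpha).2) pnormZ ?(ltW r'0)// in n1.
  rewrite zE -[r * cos _]/(r * (cos alpha, sin alpha).1) in z1.
  rewrite -[r * sin _]/(r * (cos alpha, sin alpha).2) pnormZ ?(ltW r0)// in z1.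
  have N0 : pnorm (cos alpha, sin alpha) != 0.
    by apply/eqP => N0; move: z1; rewrite N0 mulr0 => /esym/eqP; rewrite oner_eq0.
  have /(mulIf N0)/(powR_injective p0) rr : r `^ p * pnorm (cos alpha, sin alpha) =
    r' `^ p * pnorm (cos alpha, sin alpha) by rewrite n1 z1.
  by rewrite rr// nnegrE ltW.
move=> ->; split; first by apply/bdry_pball; exact: pnorm_bpoint.
have h := reduce_itv theta; rewrite -/th -{1 2}(varphiK p0 th) in h.
have [alpha [r [ha r0 bE aE]]] := exists_ray_of_bpoint (Theta_itv p0 h).
by exists alpha, r; split => //; rewrite aE varphiK.
Qed.

Lemma Ptheta_pball theta : Ptheta (pball p) theta = bpoint (varphi p theta).
Proof.
apply/is_PthetaP; apply: (@xgetPex _ (0, 0) (is_Ptheta (pball p) theta)).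
by exists (bpoint (varphi p theta)); apply/is_PthetaP.
Qed.

Lemma cosO_pball theta : cosO (pball p) theta = cosp p theta.
Proof. by rewrite /cosO Ptheta_pball. Qed.

Lemma sinO_pball theta : sinO (pball p) theta = sinp p theta.
Proof. by rewrite /sinO Ptheta_pball. Qed.

End BoundaryPoint.

(** * Young's inequality with its equality case, and polarity *)

Section Duality.
Variable R : realType.
Implicit Types (x y l m c d : R).

(** With [a] the weighted mean of the logarithms, exp(s) >= 1 + s is applied at s = ln x - a and s =
    ln y - a. The linear terms cancel in the weighted sum, and x != y makes the first inequality
    strict. *)
Lemma weighted_AMGM_lt (l m x y : R) : 0 < l -> 0 < m -> l + m = 1 ->
  0 <= x -> 0 <= y -> x != y -> x `^ l * y `^ m < l * x + m * y.
Proof.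
move=> l0 m0 lm; rewrite le_eqVlt => /predU1P[<-|x0] y0 xy.
  rewrite powR0 ?gt_eqF// mul0r mulr0 add0r mulr_gt0//.
  by rewrite lt_neqAle eq_sym y0 andbT eq_sym.
move: y0; rewrite le_eqVlt => /predU1P[y0|y0].
  by rewrite -y0 powR0 ?gt_eqF// !mulr0 addr0 mulr_gt0.
pose a := l * ln x + m * ln y.
have xa : expR a * expR (ln x - a) = x by rewrite -expRD addrC subrK lnK.
have ya : expR a * expR (ln y - a) = y by rewrite -expRD addrC subrK lnK.
have lxy : ln x - ln y != 0.
  by rewrite subr_eq0; apply: contra xy => /eqP /ln_inj -> //; rewrite posrE.
have xne : ln x - a != 0.
  have -> : ln x - a = m * (ln x - ln y).
    by rewrite /a -[X in X - _]mul1r -{1}lm; ring.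
  by rewrite mulf_neq0// gt_eqF.
have e1 : expR a * (1 + (ln x - a)) < x.
  by rewrite -[ltRHS]xa ltr_pM2l ?expR_gt0// expR_gt1Dx.
have e2 : expR a * (1 + (ln y - a)) <= y.
  by rewrite -[leRHS]ya ler_pM2l ?expR_gt0// expR_ge1Dx.
have -> : x `^ l * y `^ m = expR a by rewrite /powR !gt_eqF// expRD.
have : expR a = l * (expR a * (1 + (ln x - a))) + m * (expR a * (1 + (ln y - a))).
  rewrite [RHS](_ : _ = expR a * (l + m + (l * ln x + m * ln y) - (l + m) * a)); last by ring.
  by rewrite lm -/a mul1r addrK mulr1.
move=> {1}->; apply: ltr_leD; first by rewrite ltr_pM2l.
by rewrite ler_pM2l.
Qed.

Variables (p q : R).
Hypotheses (hp : 1 < p) (hpq : p * q = p + q).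

Lemma conjugate_gt1 : 1 < q.
Proof.
have e : (p - 1) * (q - 1) = 1.
  have -> : (p - 1) * (q - 1) = p * q - (p + q) + 1 by ring.
  by rewrite hpq subrr add0r.
by rewrite -subr_gt0 -(pmulr_rgt0 _ (_ : 0 < p - 1)) ?e// subr_gt0.
Qed.

Let p0 : 0 < p. Proof. exact: lt_trans hp. Qed.
Let q0 : 0 < q. Proof. exact: lt_trans conjugate_gt1. Qed.

Lemma conjugate_invD : p^-1 + q^-1 = 1.
Proof.
have -> : p^-1 + q^-1 = (p + q) / (p * q) by field; rewrite !gt_eqF.
by rewrite hpq divff// gt_eqF// addr_gt0.
Qed.

(** Equality in the arithmetic-geometric mean inequality for c^2 and d^2 only gives c^2 = d^2; the
    case d = -c with c nonzero is excluded because the left side is then -c^2. *)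
Lemma spow_mul_le c d : spow p c * spow q d <= p^-1 * c ^+ 2 + q^-1 * d ^+ 2 ?= iff (c == d).
Proof.
have np x r : 0 < r -> `|spow r x| = (x ^+ 2) `^ r^-1.
  by move=> r0; rewrite -(norm_spow r0) -powRrM mulfV ?gt_eqF// powRr1.
have nE : `|spow p c * spow q d| = (c ^+ 2) `^ p^-1 * (d ^+ 2) `^ q^-1.
  by rewrite normrM !np.
have le1 : spow p c * spow q d <= (c ^+ 2) `^ p^-1 * (d ^+ 2) `^ q^-1.
  by rewrite -nE ler_norm.
have AMGM : c ^+ 2 != d ^+ 2 -> (c ^+ 2) `^ p^-1 * (d ^+ 2) `^ q^-1 < p^-1 * c ^+ 2 + q^-1 * d ^+ 2.
  by apply: weighted_AMGM_lt; rewrite ?invr_gt0 ?sqr_ge0 ?conjugate_invD.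
have eqE : (c ^+ 2) `^ p^-1 * (c ^+ 2) `^ q^-1 = c ^+ 2.
  by rewrite -powRD conjugate_invD ?powRr1 ?sqr_ge0// oner_eq0.
have idE : p^-1 * c ^+ 2 + q^-1 * c ^+ 2 = c ^+ 2 by rewrite -mulrDl conjugate_invD mul1r.
have cc : spow p c * spow q c = c ^+ 2.
  rewrite -eqE -!np// /spow !normrM !normr_sg !(ger0_norm (powR_ge0 _ _)).
  have [->|cN0] := eqVneq c 0; first by rewrite sgr0 !mulr0.
  by rewrite /= !mulr1 mulrACA -expr2 sqr_sg cN0 mulr1.
apply/leifP; have [<-|cd] := eqVneq c d; first by rewrite cc idE.
have [c2d2|] := eqVneq (c ^+ 2) (d ^+ 2); last by move/AMGM; exact: le_lt_trans.
have /eqP : c ^+ 2 == d ^+ 2 by rewrite c2d2.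
move/eqP; rewrite eqf_sqr (negbTE cd)/= => /eqP cNd.
have dE : d = - c by rewrite cNd opprK.
rewrite dE spowN mulrN cc sqrrN idE -subr_gt0 opprK.
have c0 : c != 0 by apply: contra cd => /eqP c0; rewrite dE c0 oppr0.
by rewrite addr_gt0// exprn_even_gt0// c0 orbT.
Qed.

Lemma cos_eq1 x : cos x = 1 -> exists k : int, x = k%:~R * (2 * pi).
Proof.
have pi0 := pi_gt0 R; have pi2 : 0 < 2 * pi :> R by rewrite mulr_gt0.
pose k := Num.floor (x / (2 * pi)); pose y := x - k%:~R * (2 * pi).
have /andP[h1 h2] := floor_itv (x / (2 * pi)).
rewrite ler_pdivlMr// in h1; rewrite ltr_pdivrMr// intrD mulrDl mul1r in h2.
rewrite -/k in h1 h2.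
have y0 : 0 <= y by rewrite /y; lra.
have y1 : y < 2 * pi by rewrite /y; lra.
have xE : x = y + k%:~R * (2 * pi) by rewrite /y subrK.
rewrite xE (@periodic_int _ (@cos R)); last first.
  by move=> t; rewrite mulrC mulr_natr cosD2pi.
move=> cy; exists k; have [ypi|ypi] := leP y pi.
  have -> : y = 0; last by rewrite add0r.
  by apply: cos_inj; rewrite ?in_itv/= ?lexx ?y0 ?ypi ?ltW// cy cos0.
have c2 : cos (2 * pi - y) = cos 0.
  by rewrite addrC mulr_natl cosD2pi cosN cy cos0.
have : 2 * pi - y = 0.
  by apply: cos_inj c2; rewrite in_itv/=; apply/andP; split; lra.
lra.
Qed.

(** The two upper bounds add up to 1/p + 1/q = 1, so a pairing equal to 1 forces equality in both
    coordinates: the cosines agree and the sines agree. *)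
Lemma bpoint_dualP (phi psi : R) :
  spow p (cos phi) * spow q (cos psi) + spow p (sin phi) * spow q (sin psi) = 1 <->
  exists k : int, psi = phi + k%:~R * (2 * pi).
Proof.
have h := leifD (spow_mul_le (cos phi) (cos psi)) (spow_mul_le (sin phi) (sin psi)).
have rhs : p^-1 * cos phi ^+ 2 + q^-1 * cos psi ^+ 2 +
    (p^-1 * sin phi ^+ 2 + q^-1 * sin psi ^+ 2) = 1.
  by rewrite addrACA -!mulrDr !cos2Dsin2 !mulr1 conjugate_invD.
rewrite rhs in h; split.
  move/eqP; rewrite h.2 => /andP[/eqP ec /eqP es].
  have : cos (psi - phi) = 1 by rewrite cosB ec es -!expr2 cos2Dsin2.
  by move=> /cos_eq1[k e]; exists k; rewrite -e addrC subrK.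
move=> [k e]; apply/eqP; rewrite h.2 e.
rewrite (@periodic_int _ (@cos R)); last by move=> t; rewrite mulrC mulr_natr cosD2pi.
by rewrite (@periodic_int _ (@sin R)) ?eqxx// => t; rewrite mulrC mulr_natr sinD2pi.
Qed.

Lemma polar_pball : polar (pball p) = pball q.
Proof.
apply/seteqP; split => z; last first.
  move=> zq w wp; have K x y : x * y <= `|y| `^ p / p + `|x| `^ q / q.
    apply: le_trans (ler_norm _) _; rewrite normrM mulrC.
    by apply: conjugate_powR => //; exact: conjugate_invD.
  apply: le_trans (lerD (K _ _) (K _ _)) _; rewrite addrACA -!mulrDl.
  rewrite -conjugate_invD; apply: lerD.
    by rewrite -[leRHS]mul1r ler_pM2r ?invr_gt0.
  by rewrite -[leRHS]mul1r ler_pM2r ?invr_gt0.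
move=> zP; set N := pnorm q z; rewrite /pball/= -/(pnorm q z) -/N.
have N0 : 0 <= N by rewrite addr_ge0// powR_ge0.
move: N0; rewrite le_eqVlt => /predU1P[<-//|N0].
(* the Hoelder extremizer of z *)
pose w x := Num.sg x * `|x| `^ (q - 1) / N `^ p^-1.
have Np : 0 < N `^ p^-1 by exact: powR_gt0.
have qp : (q - 1) * p = q by rewrite mulrBl mul1r mulrC hpq; ring.
have q1 : q - 1 != 0 by rewrite gt_eqF// subr_gt0 conjugate_gt1.
have nw x : `|w x| `^ p = `|x| `^ q / N.
  rewrite /w !normrM normr_sg (ger0_norm (powR_ge0 _ _)) normfV (gtr0_norm Np).
  have -> : (x != 0)%:R * `|x| `^ (q - 1) = `|x| `^ (q - 1).
    by have [->|] := eqVneq x 0; rewrite ?normr0 ?powR0 ?mulr0 ?mul1r.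
  rewrite powRM ?powR_ge0 ?invr_ge0 ?powR_ge0// -powRrM qp.
  by rewrite -powRN -powRrM mulNr mulVf ?gt_eqF// powR_inv1// ltW.
have zw x : x * w x = `|x| `^ q / N `^ p^-1.
  by rewrite /w !mulrA [x * _]mulrC -normrEsg mulr_powRB1.
have /zP : pball p (w z.1, w z.2).
  by rewrite /pball/= !nw -mulrDl -/(pnorm q z) -/N divff// gt_eqF.
rewrite /= !zw -mulrDl -/(pnorm q z) -/N.
rewrite ler_pdivrMr// mul1r => NN.
(* Pairing z with the extremizer gave N <= N^(1/p); dividing by N^(1/p) leaves the exponent 1/q. *)
have Nq : N `^ q^-1 <= 1.
  rewrite -(ler_pM2l Np) mulr1.
  have -> : N `^ p^-1 * N `^ q^-1 = N; last exact: NN.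
  by rewrite -powRD conjugate_invD ?oner_eq0// powRr1// ltW.
have := powR_le_inv q0 (powR_ge0 N q^-1) ler01.
by rewrite powR1 /= Nq -powRrM mulVf ?gt_eqF// powRr1// ltW.
Qed.

End Duality.

Theorem theorem2 (R : realType) (p q : R) (hp : 1 < p) (hpq : p * q = p + q) :
  let Omega := pball p in
  [/\ forall theta : R, cosO Omega theta = cosp p theta /\ sinO Omega theta = sinp p theta,
      polar Omega = pball q,
      forall theta : R,
        (exists! t : R, varphi q t = varphi p theta) /\
        (forall t : R, dual_angle Omega theta t <->
           exists k : int, varphi q (t - k%:~R * (2 * Sp q)) = varphi p theta),
      forall theta t : R, dual_angle Omega theta t ->
        cosO (polar Omega) t = cosp q t /\ sinO (polar Omega) t = sinp q t
    & area Omega = (Sp p)%:E].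
Proof.
have p0 : 0 < p := lt_trans ltr01 hp.
have q0 : 0 < q := lt_trans ltr01 (conjugate_gt1 hp hpq).
move=> Omega; split.
- by move=> theta; rewrite /Omega cosO_pball// sinO_pball.
- exact: polar_pball.
- move=> theta; split.
    exists (Theta q (varphi p theta)); split; first by rewrite ThetaK.
    by move=> t <-; rewrite varphiK.
  move=> t; rewrite /dual_angle /Omega (polar_pball hp hpq) !cosO_pball// !sinO_pball//.
  (* A full turn of [varphi q] corresponds to a shift of its argument by [2 * Sp q], so the same
     integer serves on both sides. *)
  rewrite (bpoint_dualP hp hpq); split => -[k e]; exists k.
    by rewrite -mulNr -mulrNz varphi_shift// e mulrNz mulNr addrK.
  by rewrite -e -mulNr -mulrNz varphi_shift// mulrNz mulNr subrK.
- by move=> theta t _; rewrite /Omega (polar_pball hp hpq) cosO_pball// sinO_pball.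
- exact: area_pball.
Qed.
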